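(* Let $A$ be a Banach $*$-algebra. Assume that $A$ admits a one-sided (left or right) approximate identity consisting of elements of norm one, or merely that every $a \in A$ belongs to the norm closure of $aA_{\leq 1} = \{ab : b \in A, \ \|b\| \leq 1\}$. Then the class of non-degenerate $*$-representations of $A$ can be identified with the class of models of the theory $T^A$, via $(E,\pi) \mapsto M(E,\pi)$. That is: (i) for every non-degenerate $*$-representation $(E,\pi)$ of $A$, the structure $M(E,\pi)$ is a model of $T^A$; (ii) every model of $T^A$ is isomorphic, as an $\mathcal{L}^A$-structure, to $M(E,\pi)$ for some non-degenerate $*$-representation $(E,\pi)$ of $A$, and $(E,\pi)$ is determined by the model up to unitary equivalence of $*$-representations. Consequently the class of non-degenerate $*$-representations of $A$ may be considered to be an elementary class (in the sense of many-sorted continuous logic).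
   Context: Algebras are complex, associative, not necessarily commutative or unital. A Banach $*$-algebra is a complete normed algebra ($\|ab\|\le\|a\|\|b\|$) with a semi-linear involution $*$ such that $(ab)^*=b^*a^*$ and $\|a^*\|=\|a\|$. A $*$-representation of $A$ on a complex Hilbert space $E$ is a bounded linear map $\pi\colon A\to B(E)$ respecting multiplication and the involution (such a map is automatically contractive). It is non-degenerate if the closed subspace generated by $\{\pi(a)\xi : a\in A,\ \xi\in E\}$ is $E$. Continuous logic: structures are many-sorted bounded complete metric structures with uniformly continuous symbols. The language $\mathcal{L}^A$ has: a sort $S_a$ for each $a\in A$; on each sort $S_a$, the distance, symbols $0$ (constant), $-$ (unary), $(x,y)\mapsto\frac{x+y}{2}$ (binary), and a unary function symbol $i\colon S_a\to S_a$; for all $a,b\in A$, a real-valued predicate symbol $[\cdot,\cdot]=[\cdot,\cdot]_{a,b}$ on $S_a\times S_b$; for all $a,b\in A$, a function symbol $\pi_a\colon S_b\to S_{ab}$. Bounds and moduli of uniform continuity are those valid uniformly in all the structures $M(E,\pi)$ defined next. Given a non-degenerate $*$-representation $(E,\pi)$ of $A$, $M(E,\pi)$ is the $\mathcal{L}^A$-structure in which $S_a=\overline{\pi(a)E_{\le 1}}$, where $E_{\le1}$ is the closed unit ball of $E$; the distance is that of $E$; $0$, $-$, $\frac{x+y}{2}$ are as in $E$; $i$ is multiplication by $i$; $[\xi,\zeta]_{a,b}=\operatorname{Re}\langle\xi,\zeta\rangle$; and $\pi_a\colon S_b\to S_{ab}$ is the restriction of $\pi(a)$. A symmetric convex space is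 a complete convex subset of a real Banach space closed under $x\mapsto -x$, regarded as a metric structure with $0$, $-$, $\frac{x+y}{2}$; this can be axiomatised in continuous logic. On each sort, $\|\xi\|$ denotes $d(\xi,0)$. For finitely many elements $\xi_1,\dots,\xi_n$, possibly of different sorts, $\|\sum\xi_i\|$ is short for $\sqrt{\sum_{i,j}[\xi_i,\xi_j]}$ (and differences are written using $-$). The theory $T^A$ consists of the following axiom schemes, for all $a,b,b_1,\dots,b_n\in A$, all $n$, and all elements of all (appropriate) sorts: (Conv) each $S_a$ is a symmetric convex space of radius $\le\|a\|$ (i.e. $\|\xi\|\le\|a\|$ for $\xi\in S_a$). (Sym) $[\xi,\zeta]=[\zeta,\xi]$. (Lin1) $[\xi,\frac{\zeta+\zeta'}{2}]=\frac{[\xi,\zeta]+[\xi,\zeta']}{2}$. (Lin2) $[\xi,0]=0$. (Norm) $[\xi,\xi]=\|\xi\|^2$. (Pos) $\sum_{i,j=1}^n[\xi_i,\xi_j]\ge0$. (Pi1) $\|\sum\pi_a\xi_i\|\le\|a\|\,\|\sum\xi_i\|$. (Pi2) $a\mapsto\pi_a$ is a $*$-morphism: the identities expressing that $\pi_{a+b}\xi=\pi_a\xi+\pi_b\xi$ (meaning $\|\pi_{a+b}\xi-\pi_a\xi-\pi_b\xi\|=0$), $\pi_{\alpha a}=\alpha\pi_a$ for $\alpha\in\mathbb{C}$ (in the same sense), $\pi_{ab}\xi=\pi_a\pi_b\xi$, and $[\pi_a\xi,\zeta]=[\xi,\pi_{a^*}\zeta]$. (Complex) $i\colon S_a\to S_a$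 respects all other symbols (in particular it commutes with $0$, $-$, $\frac{x+y}{2}$ and all $\pi_b$, and $[i\xi,i\zeta]=[\xi,\zeta]$), and $i^2\xi=-\xi$. (BallImg) for all $\xi_1\in S_{b_1},\dots,\xi_n\in S_{b_n}$: $\inf_{\zeta\in S_a}\|\sum\pi_a\xi_i-\zeta\|\le\bigl|\,\|\sum\xi_i\|-1\bigr|\,\|a\|$. (DenseImg) $\sup_{\xi\in S_{ab}}\inf_{\zeta\in S_b}\|\pi_a\zeta-\xi\|=0$. (HausDist) $\sup_{\xi\in S_a}\inf_{\zeta\in S_b}\|\zeta-\xi\|\le\|a-b\|$. *)

(* Defs.v *)
From HB Require Import structures.
From mathcomp Require Import all_boot all_order all_algebra.
From mathcomp Require Import all_classical all_reals all_analysis.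
From mathcomp Require Import complex sesquilinear.
From mathcomp Require Import ring lra.

Set Implicit Arguments.
Unset Strict Implicit.
Unset Printing Implicit Defensive.

Import Order.TTheory GRing.Theory Num.Theory numFieldNormedType.Exports.
Local Open Scope complex_scope.
Local Open Scope classical_set_scope.
Local Open Scope ring_scope.

(* The library norm of a normed module over R[i] takes values in R[i];
   [rnorm] is the same norm as an element of R. *)
Definition rnorm (R : realType) (V : normedModType R[i]) (x : V) : R :=
  complex.Re `|x|.

HB.mixin Record CompleteNormedModule_isBanachStarAlgebra (R : realType) A
    & CompleteNormedModule R[i] A := {
  bmul : A -> A -> A;
  bstar : A -> A;
  bmulA : associative bmul;
  bmulDl : left_distributive bmul +%R;
  bmulDr : right_distributive bmul +%R;
  bmulZl : forall (k : R[i]) a b, bmul (k *: a) b = k *: bmul a b;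
  bmulZr : forall (k : R[i]) a b, bmul a (k *: b) = k *: bmul a b;
  bnormM : forall a b, `|bmul a b| <= `|a| * `|b|;
  bstarK : involutive bstar;
  bstarD : {morph bstar : a b / a + b};
  bstarZ : forall (k : R[i]) a, bstar (k *: a) = Num.conj k *: bstar a;
  bstarM : forall a b, bstar (bmul a b) = bmul (bstar b) (bstar a);
  bnorm_star : forall a, `|bstar a| = `|a|
}.

#[short(type="banachStarAlgType")]
HB.structure Definition BanachStarAlgebra (R : realType) :=
  {A of CompleteNormedModule R[i] A
      & CompleteNormedModule_isBanachStarAlgebra R A}.

(* [inner] is linear in the first argument, conjugate-linear in the second. *)
HB.mixin Record CompleteNormedModule_isHilbert (R : realType) E
    & CompleteNormedModule R[i] E := {
  inner : {dot E for @Num.conj R[i]};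
  normE_inner : forall x : E, `|x| ^+ 2 = inner x x
}.

#[short(type="hilbertType")]
HB.structure Definition Hilbert (R : realType) :=
  {E of CompleteNormedModule R[i] E & CompleteNormedModule_isHilbert R E}.

(* [rep_bounded] says at once that every operator [rep a] is bounded and that
   [rep] is bounded for the operator norm. *)
Record star_rep (R : realType) (A : banachStarAlgType R) (E : hilbertType R) :=
  StarRep {
    rep :> A -> E -> E;
    rep_linear : forall a, linear (rep a);
    rep_linear_alg : forall x, linear (fun a => rep a x);
    rep_bounded : exists C : R,
      forall a x, rnorm (rep a x) <= C * rnorm a * rnorm x;
    rep_mul : forall a b x, rep (bmul a b) x = rep a (rep b x);
    rep_star : forall a x y, inner (rep a x) y = inner x (rep (bstar a) y)
  }.

Definition closed_subspace (R : realType) (E : hilbertType R) (F : set E) :=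
  [/\ F 0, forall (k : R[i]) x y, F x -> F y -> F (k *: x + y) & closed F].

Definition nondegenerate_rep (R : realType) (A : banachStarAlgType R)
    (E : hilbertType R) (p : star_rep A E) :=
  smallest (@closed_subspace R E) [set x | exists a y, x = p a y] = setT.

Definition unitarily_equivalent (R : realType) (A : banachStarAlgType R)
    (E E' : hilbertType R) (p : star_rep A E) (p' : star_rep A E') :=
  exists U : E -> E',
    [/\ linear U, bijective U, forall x y, inner (U x) (U y) = inner x y &
        forall a x, U (p a x) = p' a (U x)].

(* Approximate identities are families indexed along a proper filter. *)
Definition left_norm1_approx_id (R : realType) (A : banachStarAlgType R) :=
  exists (I : Type) (F : set_system I) (e : I -> A),
    [/\ ProperFilter F, forall i, `|e i| = 1 &
        forall a : A, bmul (e i) a @[i --> F] --> a].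

Definition right_norm1_approx_id (R : realType) (A : banachStarAlgType R) :=
  exists (I : Type) (F : set_system I) (e : I -> A),
    [/\ ProperFilter F, forall i, `|e i| = 1 &
        forall a : A, bmul a (e i) @[i --> F] --> a].

Definition in_closure_mul_ball (R : realType) (A : banachStarAlgType R)
    (a : A) :=
  closure [set c : A | exists2 b : A, `|b| <= 1 & c = bmul a b] a.

(* Many-sorted continuous logic.  Symbols are interpreted by curried functions
   [curry X [:: s1; ...; sn] T = X s1 -> ... -> X sn -> T]. *)
Section Curry.
Variable S : Type.

Fixpoint curry (X : S -> Type) (ar : seq S) (T : Type) : Type :=
  if ar is s :: ar' then X s -> curry X ar' T else T.

(* The logical relation: [P]-related arguments give [Q]-related values. *)
Fixpoint curry_rel (X Y : S -> Type) (P : forall s, X s -> Y s -> Prop)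
    (T U : Type) (Q : T -> U -> Prop) (ar : seq S) :
    curry X ar T -> curry Y ar U -> Prop :=
  match ar return curry X ar T -> curry Y ar U -> Prop with
  | [::] => Q
  | s :: ar' => fun f g => forall x y, P s x y ->
      @curry_rel X Y P T U Q ar' (f x) (g y)
  end.

End Curry.

Section ContinuousLogic.
Variable R : realType.

(* Uniform continuity is recorded by inverse moduli: if all the arguments move
   by at most r, then the value moves by at most [lfun_mod f r], resp.
   [lpred_mod p r]. *)
Record language := Language {
  lsort : Type;
  lfun : Type;
  lfun_dom : lfun -> seq lsort;
  lfun_cod : lfun -> lsort;
  lpred : Type;
  lpred_dom : lpred -> seq lsort;
  lsort_diam : lsort -> R;
  lpred_bound : lpred -> R;
  lfun_mod : lfun -> R -> R;
  lpred_mod : lpred -> R -> R;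
  lfun_mod_cvg0 : forall f, lfun_mod f r @[r --> 0^'+] --> 0;
  lpred_mod_cvg0 : forall p, lpred_mod p r @[r --> 0^'+] --> 0
}.

Variable L : language.

Definition within_dist (X : lsort L -> metricType R) (r : R) (s : lsort L)
    (x y : X s) := mdist x y <= r.

Record lstructure := LStructure {
  carrier :> lsort L -> metricType R;
  fun_interp : forall f, curry carrier (lfun_dom f) (carrier (lfun_cod f));
  pred_interp : forall p, curry carrier (lpred_dom p) R;
  carrier_inhabited : forall s, inhabited (carrier s);
  carrier_complete : forall s (F : set_system (carrier s)),
    ProperFilter F -> cauchy F -> exists x : carrier s, F --> x;
  carrier_diam : forall s (x y : carrier s), mdist x y <= lsort_diam s;
  pred_interp_bound : forall p,
    curry_rel (fun s (_ _ : carrier s) => True)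
      (fun u _ : R => `|u| <= lpred_bound p) (pred_interp p) (pred_interp p);
  fun_interp_unif : forall f r, 0 <= r ->
    curry_rel (@within_dist carrier r)
      (@within_dist carrier (lfun_mod f r) (lfun_cod f))
      (fun_interp f) (fun_interp f);
  pred_interp_unif : forall p r, 0 <= r ->
    curry_rel (@within_dist carrier r)
      (fun u v : R => `|u - v| <= lpred_mod p r)
      (pred_interp p) (pred_interp p)
}.

Definition isomorphic (M N : lstructure) :=
  exists h : forall s, M s -> N s,
    [/\ forall s, bijective (@h s),
        forall s (x y : M s), mdist (h s x) (h s y) = mdist x y,
        forall f, curry_rel (fun s (x : M s) (y : N s) => y = h s x)
          (fun x y => y = h (lfun_cod f) x) (fun_interp M f) (fun_interp N f) &
        forall p, curry_rel (fun s (x : M s) (y : N s) => y = h s x)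
          (fun u v => v = u) (pred_interp M p) (pred_interp N p)].

(* Well-sorted de Bruijn variables in a context listing their sorts. *)
Inductive var : seq (lsort L) -> lsort L -> Type :=
| VarO G s : var (s :: G) s
| VarS G s t : var G s -> var (t :: G) s.

Inductive term (G : seq (lsort L)) : lsort L -> Type :=
| TVar s : var G s -> term G s
| TApp f : terms G (lfun_dom f) -> term G (lfun_cod f)
with terms (G : seq (lsort L)) : seq (lsort L) -> Type :=
| TNil : terms G [::]
| TCons s ss : term G s -> terms G ss -> terms G (s :: ss).

(* Connectives are all the continuous functions R^n -> R, n >= 0. *)
Inductive formula : seq (lsort L) -> Type :=
| FDist G s : term G s -> term G s -> formula G
| FPred G p : terms G (lpred_dom p) -> formula G
| FConn G n (u : 'rV[R]_n -> R) :
    continuous u -> ('I_n -> formula G) -> formula G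
| FSup G s : formula (s :: G) -> formula G
| FInf G s : formula (s :: G) -> formula G.

Section Semantics.
Variable M : lstructure.

Fixpoint env (G : seq (lsort L)) : Type :=
  if G is s :: G' then (M s * env G')%type else unit.

Fixpoint var_eval G s (v : var G s) : env G -> M s :=
  match v in var G s return env G -> M s with
  | VarO _ _ => fun e => e.1
  | VarS _ _ _ v' => fun e => var_eval v' e.2
  end.

Fixpoint term_eval G (e : env G) s (t : term G s) : M s :=
  match t in term _ s return M s with
  | TVar _ v => var_eval v e
  | TApp f ts => terms_eval e ts (fun_interp M f)
  end
with terms_eval G (e : env G) ss (ts : terms G ss) (T : Type) :
    curry (carrier M) ss T -> T :=
  match ts in terms _ ss return curry (carrier M) ss T -> T with
  | TNil => id
  | TCons _ _ t ts' => fun f => terms_eval e ts' (f (term_eval e t))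
  end.

Fixpoint formula_eval G (phi : formula G) : env G -> R :=
  match phi in formula G return env G -> R with
  | FDist _ _ t t' => fun e => mdist (term_eval e t) (term_eval e t')
  | FPred _ p ts => fun e => terms_eval e ts (pred_interp M p)
  | FConn _ n u _ phis => fun e => u (\row_i formula_eval (phis i) e)
  | FSup _ s phi' => fun e =>
      sup (range (fun x : M s => formula_eval phi' (x, e)))
  | FInf _ s phi' => fun e =>
      inf (range (fun x : M s => formula_eval phi' (x, e)))
  end.

End Semantics.

Definition sentence := formula [::].

Definition theory := set sentence.

(* A sentence phi stands for the condition phi = 0. *)
Definition satisfies (M : lstructure) (T : theory) :=
  forall phi, T phi -> @formula_eval M [::] phi tt = 0.

Definition axiomatizes (T : theory) (K : lstructure -> Prop) :=
  forall M, satisfies M T <-> K M.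

End ContinuousLogic.

Section LanguageLA.
Variables (R : realType) (A : banachStarAlgType R).

Inductive LA_fun : Type :=
| LA_zero of A
| LA_opp of A
| LA_mid of A
| LA_i of A
| LA_pi of A & A.

Definition LA_dom (f : LA_fun) : seq A :=
  match f with
  | LA_zero a => [::]
  | LA_opp a => [:: a]
  | LA_mid a => [:: a; a]
  | LA_i a => [:: a]
  | LA_pi a b => [:: b]
  end.

Definition LA_cod (f : LA_fun) : A :=
  match f with
  | LA_zero a => a
  | LA_opp a => a
  | LA_mid a => a
  | LA_i a => a
  | LA_pi a b => bmul a b
  end.

Definition LA_mod (f : LA_fun) (r : R) : R :=
  if f is LA_pi a b then rnorm a * r else r.

Definition LA_pred_mod (p : A * A) (r : R) : R :=
  (rnorm p.1 + rnorm p.2) * r.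

Lemma mulr_cvg0 (c : R) : c * r @[r --> 0^'+] --> (0 : R).
Proof.
suff : c * r @[r --> 0^'+] --> c * 0 by rewrite mulr0.
by apply: cvgMr; apply: cvg_at_right_filter; exact: cvg_id.
Qed.

Lemma LA_mod_cvg0 f : LA_mod f r @[r --> 0^'+] --> 0.
Proof.
case: f => *; try exact: mulr_cvg0.
all: by apply: cvg_at_right_filter; exact: cvg_id.
Qed.

(* The predicate symbol (a, b) is [., .]_{a,b}.  The bounds and moduli are those
   following from ||p(a)|| <= ||a|| for every star-representation p. *)
Definition LA : language R := {|
  lsort := A;
  lfun := LA_fun;
  lfun_dom := LA_dom;
  lfun_cod := LA_cod;
  lpred := A * A;
  lpred_dom := fun p => [:: p.1; p.2];
  lsort_diam := fun a => 2 * rnorm a;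
  lpred_bound := fun p => rnorm p.1 * rnorm p.2;
  lfun_mod := LA_mod;
  lpred_mod := LA_pred_mod;
  lfun_mod_cvg0 := LA_mod_cvg0;
  lpred_mod_cvg0 := fun p => mulr_cvg0 (rnorm p.1 + rnorm p.2)
|}.

End LanguageLA.

Section RNorm.
Variables (R : realType) (V : normedModType R[i]).
Implicit Types x y : V.

Lemma rnormE x : `|x| = (rnorm x)%:C.
Proof. by rewrite /rnorm RRe_real// ger0_real. Qed.

Lemma rnorm_ge0 x : 0 <= rnorm x.
Proof. by have := normr_ge0 x; rewrite lecE => /andP[]. Qed.

Lemma rnorm0 : rnorm (0 : V) = 0.
Proof. by rewrite /rnorm normr0. Qed.

Lemma rnorm_eq0 x : rnorm x = 0 -> x = 0.
Proof. by move=> x0; apply/eqP; rewrite -normr_eq0 rnormE x0. Qed.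

Lemma rnormN x : rnorm (- x) = rnorm x.
Proof. by rewrite /rnorm normrN. Qed.

Lemma ler_rnormD x y : rnorm (x + y) <= rnorm x + rnorm y.
Proof. by rewrite -lecR rmorphD/= -!rnormE ler_normD. Qed.

Lemma rnorm_sub x y : rnorm (x - y) = rnorm (y - x).
Proof. by rewrite -rnormN opprB. Qed.

Lemma rnormZ (k : R[i]) x : rnorm (k *: x) = complex.Re `|k| * rnorm x.
Proof.
apply: complexI; rewrite rmorphM -!rnormE normrZ; congr (_ * _).
by symmetry; apply: RRe_real; rewrite ger0_real.
Qed.

Lemma rnorm_le1 x : (`|x| <= 1) = (rnorm x <= 1).
Proof. by rewrite rnormE -lecR. Qed.

Lemma closure_rnorm (X : set V) x :
  closure X x <-> forall e : R, 0 < e -> exists2 y, X y & rnorm (x - y) < e.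
Proof.
split=> [Xx e e0|Xx B /nbhs_ballP[e /= e0 xB]].
  have e0' : 0 < e%:C by rewrite ltcR.
  have [y [Xy]] := Xx _ (nbhsx_ballx x e%:C e0').
  by rewrite -ball_normE/= rnormE ltcR; exists y.
have eE : (complex.Re e)%:C = e by rewrite RRe_real// gtr0_real.
have [|y Xy xy] := Xx (complex.Re e); first by rewrite -ltcR eE.
by exists y; split=> //; apply: xB; rewrite -ball_normE/= rnormE -eE ltcR.
Qed.

End RNorm.

Section InnerBound.
Variables (R : realType) (E : hilbertType R).
Implicit Types x y : E.

Lemma inner_rnorm x : inner x x = (rnorm x ^+ 2)%:C.
Proof. by rewrite -normE_inner rnormE rmorphXn. Qed.

Lemma Re_inner_sqr x : complex.Re (inner x x) = rnorm x ^+ 2.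
Proof. by rewrite inner_rnorm. Qed.

Lemma innerC x y : inner x y = (inner y x)^*%C.
Proof. by rewrite [LHS]hermC expr0 mul1r. Qed.

Lemma Re_innerC x y : complex.Re (inner x y) = complex.Re (inner y x).
Proof. by rewrite innerC; case: (inner y x). Qed.

Lemma Re_inner_le x y : complex.Re (inner x y) <= rnorm x * rnorm y.
Proof.
have [/rnorm_eq0->|x0] := eqVneq (rnorm x) 0.
  by rewrite linear0l rnorm0 mul0r.
have [/rnorm_eq0->|y0] := eqVneq (rnorm y) 0.
  by rewrite linear0r rnorm0 mulr0.
pose u := (rnorm y)%:C *: x - (rnorm x)%:C *: y.
have : 0 <= complex.Re (inner u u) by rewrite Re_inner_sqr sqr_ge0.
rewrite /u linearBl/= !linearBr/= !linearZl_LR/= !linearZr_LR/=.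
rewrite !inner_rnorm.
rewrite (innerC y x).
have xp : 0 < rnorm x by rewrite lt_neqAle eq_sym x0 rnorm_ge0.
have yp : 0 < rnorm y by rewrite lt_neqAle eq_sym y0 rnorm_ge0.
case: (inner x y) => p q /=.
set a := rnorm x in xp *; set b := rnorm y in yp *.
have ab : 0 < a * b by rewrite mulr_gt0.
move=> H.
have {H} : 0 <= a * b * (a * b - p) *+ 2.
  by apply: le_trans H _; rewrite le_eqVlt; apply/orP; left; apply/eqP; ring.
by rewrite pmulrn_lge0// pmulr_rge0// subr_ge0.
Qed.

Lemma normr_Re_inner x y : `|complex.Re (inner x y)| <= rnorm x * rnorm y.
Proof.
rewrite ler_norml Re_inner_le andbT lerNl.
rewrite -[in leRHS](rnormN x); apply: le_trans (Re_inner_le _ _).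
have ReN (z : R[i]) : complex.Re (- z) = - complex.Re z by case: z.
by rewrite linearNl ReN.
Qed.

End InnerBound.

Section Contractive.
Variables (R : realType) (A : banachStarAlgType R) (E : hilbertType R).
Variable p : star_rep A E.

Lemma rep0 a : p a 0 = 0.
Proof.
by have := rep_linear p a (-1) 0 0; rewrite !scaleN1r oppr0 addr0 addNr.
Qed.

Lemma repD a : {morph p a : x y / x + y}.
Proof. by move=> x y; have := rep_linear p a 1 x y; rewrite !scale1r. Qed.

Lemma repZ a (k : R[i]) x : p a (k *: x) = k *: p a x.
Proof. by have := rep_linear p a k x 0; rewrite rep0 !addr0. Qed.

Lemma repN a x : p a (- x) = - p a x.
Proof. by rewrite -scaleN1r repZ scaleN1r. Qed.

Lemma rep_contractive a x : rnorm (p a x) <= rnorm a * rnorm x.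
Proof.
suff H1 b z : rnorm z = 1 -> rnorm (p b z) <= rnorm b.
  have [/rnorm_eq0->|x0] := eqVneq (rnorm x) 0.
    by rewrite rep0 rnorm0 mulr0.
  have xp : 0 < rnorm x by rewrite lt_neqAle eq_sym x0 rnorm_ge0.
  have nV : complex.Re `|((rnorm x)^-1)%:C| = (rnorm x)^-1.
    by rewrite ger0_norm// lecR invr_ge0 ltW.
  have := H1 a (((rnorm x)^-1)%:C *: x).
  by rewrite repZ !rnormZ nV mulVf// => /(_ erefl); rewrite ler_pdivrMl// mulrC.
have [C pC] := rep_bounded p.
pose s n := iter n (fun c : A => bmul (bstar c) c) b.
have step c : rnorm z = 1 -> rnorm (p c z) ^+ 2 <= rnorm (p (bmul (bstar c) c) z).
  move=> z1; rewrite -Re_inner_sqr rep_star rep_mul.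
  by apply: le_trans (Re_inner_le _ _) _; rewrite z1 mul1r.
move=> z1.
have s_norm n : rnorm (s n) <= rnorm b ^+ (2 ^ n).
  elim: n => [|n IH]; first by rewrite expr1.
  rewrite /= expnSr exprM; apply: (@le_trans _ _ (rnorm (s n) ^+ 2)).
    by rewrite -lecR rmorphXn/= -!rnormE (le_trans (bnormM _ _))// bnorm_star.
  by rewrite lerXn2r// nnegrE ?rnorm_ge0// exprn_ge0// rnorm_ge0.
have s_rep n : rnorm (p b z) ^+ (2 ^ n) <= rnorm (p (s n) z).
  elim: n => [|n IH]; first by rewrite expr1.
  rewrite expnSr exprM; apply: le_trans (step _ z1).
  by rewrite lerXn2r// nnegrE ?rnorm_ge0// exprn_ge0// rnorm_ge0.
have C_ge0 : 0 <= Num.max C 0 by rewrite le_max lexx orbT.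
have bound n : rnorm (p b z) ^+ (2 ^ n) <= Num.max C 0 * rnorm b ^+ (2 ^ n).
  apply: le_trans (s_rep n) _; apply: le_trans (pC _ _) _; rewrite z1 mulr1.
  apply: (@le_trans _ _ (Num.max C 0 * rnorm (s n))).
    by rewrite ler_wpM2r ?rnorm_ge0// le_max lexx.
  by rewrite ler_wpM2l.
rewrite leNgt; apply/negP => lt_b.
have [b0|bN0] := eqVneq (rnorm b) 0.
  by move: (bound 0) lt_b; rewrite !expr1 b0 mulr0 => /le_lt_trans H /H; rewrite ltxx.
have bp : 0 < rnorm b by rewrite lt_neqAle eq_sym bN0 rnorm_ge0.
pose t := rnorm (p b z) / rnorm b.
have t1 : 1 < t by rewrite /t ltr_pdivlMr// mul1r.
have tC n : t ^+ (2 ^ n) <= Num.max C 0.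
  by rewrite /t expr_div_n ler_pdivrMr ?exprn_gt0.
have tn n : n%:R * (t - 1) <= Num.max C 0.
  apply: le_trans (tC n).
  have : n%:R * (t - 1) <= (2 ^ n)%:R * (t - 1).
    by rewrite ler_wpM2r ?subr_ge0 ?(ltW t1)// ler_nat ltnW// ltn_expl.
  move/le_trans; apply.
  elim: (2 ^ n)%N => [|m IH]; first by rewrite mul0r exprn_ge0// (le_trans ler01)// ltW.
  rewrite -natr1 mulrDl mul1r exprSr.
  have tm : 1 <= t ^+ m by rewrite exprn_ege1// ltW.
  have : 0 <= (t ^+ m - 1) * (t - 1) by rewrite mulr_ge0// subr_ge0// ltW.
  lra.
have t10 : 0 < t - 1 by rewrite subr_gt0.
have := archi_boundP (divr_ge0 C_ge0 (ltW t10)).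
by rewrite ltr_pdivrMr// ltNge tn.
Qed.

End Contractive.

Section RepStructure.
Variables (R : realType) (A : banachStarAlgType R) (E : hilbertType R).
Variable p : star_rep A E.

Definition rep_sort (a : A) : set E :=
  closure [set p a x | x in [set x : E | `|x| <= 1]].

Record rep_carrier (a : A) := RepCarrier {
  rep_val :> E;
  rep_valP : rep_sort a rep_val
}.

Arguments rep_valP {a} r.

Lemma rep_val_inj a : injective (@rep_val a).
Proof.
move=> [x Px] [y Py] /= xy; rewrite -xy in Py *.
by congr RepCarrier; exact: Prop_irrelevance.
Qed.

HB.instance Definition _ a := gen_eqMixin (rep_carrier a).
HB.instance Definition _ a := gen_choiceMixin (rep_carrier a).

Section Metric.
Variable a : A.

Definition rep_dist (x y : rep_carrier a) : R := rnorm (rep_val x - rep_val y).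

Lemma rep_distxx x : rep_dist x x = 0.
Proof. by rewrite /rep_dist subrr rnorm0. Qed.

Lemma rep_dist_positivity x y : rep_dist x y = 0 -> x = y.
Proof.
by move=> /rnorm_eq0/eqP; rewrite subr_eq0 => /eqP; exact: rep_val_inj.
Qed.

Lemma rep_dist_sym x y : rep_dist x y = rep_dist y x.
Proof. exact: rnorm_sub. Qed.

Lemma rep_dist_triangle y x z : rep_dist x z <= rep_dist x y + rep_dist y z.
Proof.
rewrite /rep_dist; apply: le_trans (ler_rnormD _ _).
by rewrite addrA subrK.
Qed.

HB.instance Definition _ := isMetric.Build R (rep_carrier a)
  rep_distxx rep_dist_positivity rep_dist_sym rep_dist_triangle.

End Metric.

Lemma rep_sortP a (x : E) : rep_sort a x <->
  forall e : R, 0 < e -> exists2 y, rnorm y <= 1 & rnorm (x - p a y) < e.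
Proof.
split=> [/closure_rnorm ax e /ax[_ [y /= y1 <-] xy]|ax].
  by exists y => //; rewrite -rnorm_le1.
apply/closure_rnorm => e /ax[y y1 xy]; exists (p a y) => //.
by exists y => //=; rewrite rnorm_le1.
Qed.

Lemma rep_sort_rnorm a x : rep_sort a x -> rnorm x <= rnorm a.
Proof.
move=> /rep_sortP ax; apply/ler_addgt0Pr => e /ax[y y1 xy].
rewrite -[x](subrK (p a y)) addrC (le_trans (ler_rnormD _ _))//.
rewrite lerD// ?(ltW xy)// (le_trans (rep_contractive _ _ _))//.
by rewrite ler_piMr// rnorm_ge0.
Qed.

Lemma rep_sort0 a : rep_sort a 0.
Proof.
apply/rep_sortP => e e0; exists 0; first by rewrite rnorm0.
by rewrite rep0 subr0 rnorm0.
Qed.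

Lemma rep_sortN a x : rep_sort a x -> rep_sort a (- x).
Proof.
move=> /rep_sortP ax; apply/rep_sortP => e /ax[y y1 xy].
by exists (- y); rewrite ?rnormN// repN -opprD rnormN.
Qed.

Lemma Re_normC_half : complex.Re `|2^-1 : R[i]| = 2^-1 :> R.
Proof.
have -> : (2^-1 : R[i]) = (2^-1)%:C by rewrite fmorphV rmorph_nat.
by rewrite ger0_norm// lecR.
Qed.

Lemma rnorm_half_le (x y : E) r : rnorm x <= r -> rnorm y <= r ->
  rnorm (2^-1 *: (x + y)) <= r.
Proof.
move=> xr yr; rewrite rnormZ Re_normC_half.
rewrite mulrC ler_pdivrMr// mulr_natr mulr2n.
by rewrite (le_trans (ler_rnormD _ _))// lerD.
Qed.

Lemma rep_sort_mid a x y : rep_sort a x -> rep_sort a y ->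
  rep_sort a (2^-1 *: (x + y)).
Proof.
move=> /rep_sortP ax /rep_sortP ay; apply/rep_sortP => e e0.
have e20 : 0 < e / 2 by rewrite divr_gt0.
have [[x' x1 xx] [y' y1 yy]] := (ax _ e20, ay _ e20).
exists (2^-1 *: (x' + y')); first exact: rnorm_half_le.
rewrite repZ repD -scalerBr opprD addrACA.
apply: (@le_lt_trans _ _ (e / 2)); last by rewrite ltr_pdivrMr// ltr_pMr// ltr1n.
by apply: rnorm_half_le; exact: ltW.
Qed.

Lemma Re_normC_i : complex.Re `|'i%C : R[i]| = 1 :> R.
Proof. by rewrite normc_def/= expr0n/= add0r expr1n sqrtr1. Qed.

Lemma rep_sort_i a x : rep_sort a x -> rep_sort a ('i%C *: x).
Proof.
move=> /rep_sortP ax; apply/rep_sortP => e /ax[y y1 xy].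
exists ('i%C *: y); first by rewrite rnormZ Re_normC_i mul1r.
by rewrite repZ -scalerBr rnormZ Re_normC_i mul1r.
Qed.

Lemma rep_sort_pi a b x : rep_sort b x -> rep_sort (bmul a b) (p a x).
Proof.
move=> /rep_sortP bx; apply/rep_sortP => e e0.
have a1 : 0 < rnorm a + 1 by rewrite ltr_wpDl ?rnorm_ge0.
have [|y y1 xy] := bx (e / (rnorm a + 1)); first by rewrite divr_gt0.
exists y => //; rewrite rep_mul -repN -repD.
rewrite (le_lt_trans (rep_contractive _ _ _))//.
rewrite (@le_lt_trans _ _ ((rnorm a + 1) * rnorm (x - p b y)))//.
  by rewrite ler_wpM2r ?rnorm_ge0// lerDl.
by rewrite mulrC -ltr_pdivlMr.
Qed.

Lemma rep_carrier_complete a (F : set_system (rep_carrier a)) :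
  ProperFilter F -> cauchy F -> exists x : rep_carrier a, F --> x.
Proof.
move=> FF /cauchy_ballP Fc.
have FvC : cauchy (@rep_val a @ F).
  apply/cauchy_ballP => e e0.
  have eE : (complex.Re e)%:C = e by rewrite RRe_real// gtr0_real.
  have e0' : 0 < complex.Re e by rewrite -ltcR eE.
  have [[P Q] /= [FP FQ] PQ] := Fc _ e0'.
  exists ((@rep_val a @` P), (@rep_val a @` Q)) => /=.
    by split; [apply: filterS FP|apply: filterS FQ] => x Px; exists x.
  move=> [_ _] /= [[x Px <-] [y Qy <-]].
  have := PQ (x, y) (conj Px Qy); rewrite /= ballEmdist/= => xy.
  by rewrite -ball_normE/= rnormE -eE ltcR.
have : cvg (@rep_val a @ F) by exact: cauchy_cvg.
move=> /cvg_ex[l Fl].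
have lP (e : R) : 0 < e -> F [set x | rnorm (l - rep_val x) < e].
  move=> e0; have e0' : 0 < e%:C by rewrite ltcR.
  have Fl' : F (@rep_val a @^-1` ball l e%:C).
    exact: Fl _ (nbhsx_ballx l e%:C e0').
  apply: filterS Fl' => x.
  by rewrite /= -ball_normE/= rnormE ltcR.
have la : rep_sort a l.
  apply/rep_sortP => e e0.
  have e20 : 0 < e / 2 by rewrite divr_gt0.
  have [x /= lx] := filter_ex (lP _ e20).
  have [y y1 xy] := (rep_sortP a x).1 (rep_valP x) _ e20.
  exists y => //; rewrite -[l](subrK (rep_val x)) -addrA.
  by rewrite (le_lt_trans (ler_rnormD _ _))// [ltRHS]splitr ltrD.
exists (RepCarrier la) => B /nbhs_ballP[e /= e0 lB].
apply: filterS (lP e e0) => x xl; apply: lB.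
by rewrite ballEmdist.
Qed.

Definition rep_fun (f : LA_fun A) :
    curry rep_carrier (LA_dom f) (rep_carrier (LA_cod f)) :=
  match f return curry rep_carrier (LA_dom f) (rep_carrier (LA_cod f)) with
  | LA_zero a => RepCarrier (rep_sort0 a)
  | LA_opp a => fun x => RepCarrier (rep_sortN (rep_valP x))
  | LA_mid a => fun x y =>
      RepCarrier (rep_sort_mid (rep_valP x) (rep_valP y))
  | LA_i a => fun x => RepCarrier (rep_sort_i (rep_valP x))
  | LA_pi a b => fun x => RepCarrier (@rep_sort_pi a b _ (rep_valP x))
  end.

Definition rep_pred (q : A * A) : rep_carrier q.1 -> rep_carrier q.2 -> R :=
  fun x y => complex.Re (inner (rep_val x) (rep_val y)).

Lemma rep_diam a (x y : rep_carrier a) : mdist x y <= 2 * rnorm a.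
Proof.
rewrite /mdist/= /rep_dist (le_trans (ler_rnormD _ _))// rnormN mulr_natl mulr2n.
by rewrite lerD// rep_sort_rnorm//; exact: rep_valP.
Qed.

Lemma rep_pred_bound (q : A * A) (x : rep_carrier q.1) (y : rep_carrier q.2) :
  `|rep_pred x y| <= rnorm q.1 * rnorm q.2.
Proof.
apply: le_trans (normr_Re_inner _ _) _.
by rewrite ler_pM ?rnorm_ge0// rep_sort_rnorm//; exact: rep_valP.
Qed.

Lemma rep_fun_unif (f : LA_fun A) (r : R) : 0 <= r ->
  curry_rel (@within_dist R (LA A) rep_carrier r)
    (@within_dist R (LA A) rep_carrier (LA_mod f r) (LA_cod f))
    (rep_fun f) (rep_fun f).
Proof.
move=> r0; rewrite /within_dist /mdist/= /rep_dist.
case: f => [a|a|a|a|a b] /=.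
- by rewrite subrr rnorm0.
- by move=> x y; rewrite -opprD rnormN.
- move=> x y xy x' y' xy'.
  by rewrite -scalerBr opprD addrACA rnorm_half_le.
- by move=> x y; rewrite -scalerBr rnormZ Re_normC_i mul1r.
- move=> x y xy; rewrite -repN -repD (le_trans (rep_contractive _ _ _))//.
  by rewrite ler_wpM2l// rnorm_ge0.
Qed.

Lemma rep_pred_unif (q : A * A) (r : R) : 0 <= r ->
  forall x y : rep_carrier q.1, mdist x y <= r ->
  forall x' y' : rep_carrier q.2, mdist x' y' <= r ->
  `|rep_pred x x' - rep_pred y y'| <= LA_pred_mod q r.
Proof.
move=> r0 x y xy x' y' xy'.
have -> : rep_pred x x' - rep_pred y y' =
    complex.Re (inner (rep_val x - rep_val y) (rep_val x')) +
    complex.Re (inner (rep_val y) (rep_val x' - rep_val y')).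
  rewrite /rep_pred linearBl/= linearBr/=.
  case: (inner (rep_val x) _) (inner (rep_val y) (rep_val x')) => ? ? [? ?].
  by case: (inner (rep_val y) (rep_val y')) => ? ? /=; ring.
rewrite (le_trans (ler_normD _ _))// /LA_pred_mod mulrDl addrC lerD//.
  rewrite (le_trans (normr_Re_inner _ _))// ler_pM ?rnorm_ge0//.
  by apply: rep_sort_rnorm; exact: rep_valP.
rewrite (le_trans (normr_Re_inner _ _))// mulrC ler_pM ?rnorm_ge0//.
by apply: rep_sort_rnorm; exact: rep_valP.
Qed.

(* The structure M(E, p); the star-representation p need not be non-degenerate. *)
Definition rep_structure : lstructure (LA A) := {|
  carrier := (fun a => rep_carrier a : metricType R) : lsort (LA A) -> _;
  fun_interp := rep_fun;
  pred_interp := rep_pred : forall q : lpred (LA A), _;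
  carrier_inhabited := fun a => inhabits (RepCarrier (rep_sort0 a));
  carrier_complete := rep_carrier_complete;
  carrier_diam := rep_diam;
  pred_interp_bound := fun q x _ _ y _ _ => rep_pred_bound x y;
  fun_interp_unif := rep_fun_unif;
  pred_interp_unif := rep_pred_unif
|}.

End RepStructure.

Section TheoryTA.
Variables (R : realType) (A : banachStarAlgType R) (M : lstructure (LA A)).

Definition mzero (a : A) : M a := fun_interp M (LA_zero a).
Definition mopp (a : A) : M a -> M a := fun_interp M (LA_opp a).
Definition mmid (a : A) : M a -> M a -> M a := fun_interp M (LA_mid a).
Definition mi (a : A) : M a -> M a := fun_interp M (LA_i a).
Definition mpi (a b : A) : M b -> M (bmul a b) := fun_interp M (LA_pi a b).
Definition mbr (a b : A) : M a -> M b -> R := pred_interp M (a, b).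

(* Elements of arbitrary sorts, and finite sequences of them. *)
Definition elt := {a : A & M a}.
Definition mkelt (a : A) (x : M a) : elt := existT _ a x.
Definition elt_br (x y : elt) : R := mbr (projT2 x) (projT2 y).
Definition elt_pi (a : A) (x : elt) : elt := mkelt (mpi a (projT2 x)).
Definition elt_opp (x : elt) : elt := mkelt (mopp (projT2 x)).
Definition elt_i (x : elt) : elt := mkelt (mi (projT2 x)).

Definition br_sum (s : seq elt) : R := \sum_(x <- s) \sum_(y <- s) elt_br x y.

(* || sum_(x <- s) x || *)
Definition norm_sum (s : seq elt) : R := Num.sqrt (br_sum s).

(* || sum_((c, x) <- s) c x ||, with real coefficients c *)
Definition norm_comb (s : seq (R * elt)) : R :=
  Num.sqrt (\sum_(x <- s) \sum_(y <- s) x.1 * y.1 * elt_br x.2 y.2).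

(* The complete metric space M a, with 0, - and midpoint, is isometric to a
   convex symmetric subset of a real Banach space. *)
Definition symmetric_convex_space (a : A) :=
  exists (V : completeNormedModType R) (e : M a -> V),
    [/\ forall x y, mdist x y = `|e x - e y|,
        convex_set (range e : set (convex_lmodType V)),
        e (mzero a) = 0,
        forall x, e (mopp x) = - e x &
        forall x y, e (mmid x y) = 2^-1 *: (e x + e y)].

(* Sups and infs below are over non-empty sets, bounded because predicates are.
   In [ax_Pi2_scale], for k = s + t i, the norm is that of
   pi_{k a} x - s pi_a x - t i pi_a x.  In [ax_Pi2_mul], the two sides lie in the
   sorts (a b) c and a (b c), equal by associativity but not convertible, whence
   the equality in [elt]. *)
Record model_TA : Prop := ModelTA {
  ax_Conv : forall a, symmetric_convex_space a;
  ax_Conv_radius : forall a (x : M a), mdist x (mzero a) <= rnorm a;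
  ax_Sym : forall a b (x : M a) (y : M b), mbr x y = mbr y x;
  ax_Lin1 : forall a b (x : M a) (y y' : M b),
    mbr x (mmid y y') = (mbr x y + mbr x y') / 2;
  ax_Lin2 : forall a b (x : M a), mbr x (mzero b) = 0;
  ax_Norm : forall a (x : M a), mbr x x = mdist x (mzero a) ^+ 2;
  ax_Pos : forall s : seq elt, 0 <= br_sum s;
  ax_Pi1 : forall a (s : seq elt),
    norm_sum [seq elt_pi a x | x <- s] <= rnorm a * norm_sum s;
  ax_Pi2_add : forall a b (x : elt),
    norm_sum [:: elt_pi (a + b) x; elt_opp (elt_pi a x);
                 elt_opp (elt_pi b x)] = 0;
  ax_Pi2_scale : forall (k : R[i]) a (x : elt),
    norm_comb [:: (1, elt_pi (k *: a) x); (- complex.Re k, elt_pi a x);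
                  (- complex.Im k, elt_i (elt_pi a x))] = 0;
  ax_Pi2_mul : forall a b (x : elt),
    elt_pi (bmul a b) x = elt_pi a (elt_pi b x);
  ax_Pi2_star : forall a b c (x : M b) (y : M c),
    mbr (mpi a x) y = mbr x (mpi (bstar a) y);
  ax_Complex_dist : forall a (x y : M a), mdist (mi x) (mi y) = mdist x y;
  ax_Complex_zero : forall a, mi (mzero a) = mzero a;
  ax_Complex_opp : forall a (x : M a), mi (mopp x) = mopp (mi x);
  ax_Complex_mid : forall a (x y : M a), mi (mmid x y) = mmid (mi x) (mi y);
  ax_Complex_pi : forall a b (x : M b), mi (mpi a x) = mpi a (mi x);
  ax_Complex_br : forall a b (x : M a) (y : M b), mbr (mi x) (mi y) = mbr x y;
  ax_Complex_sqr : forall a (x : M a), mi (mi x) = mopp x;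
  ax_BallImg : forall a (s : seq elt),
    inf (range (fun z : M a =>
      norm_sum (rcons [seq elt_pi a x | x <- s] (mkelt (mopp z)))))
    <= `|norm_sum s - 1| * rnorm a;
  ax_DenseImg : forall a b,
    sup (range (fun x : M (bmul a b) => inf (range (fun z : M b =>
      norm_sum [:: mkelt (mpi a z); mkelt (mopp x)])))) = 0;
  ax_HausDist : forall a b,
    sup (range (fun x : M a => inf (range (fun z : M b =>
      norm_sum [:: mkelt z; mkelt (mopp x)])))) <= rnorm (a - b)
}.

End TheoryTA.

(* Main.v *)
Require Import Defs.
From HB Require Import structures.
From mathcomp Require Import all_boot all_order all_algebra.
From mathcomp Require Import all_classical all_reals all_analysis.
From mathcomp Require Import complex sesquilinear.
From mathcomp Require Import ring lra.

Set Implicit Arguments.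
Unset Strict Implicit.
Unset Printing Implicit Defensive.

Import Defs Order.TTheory GRing.Theory Num.Theory numFieldNormedType.Exports.
Local Open Scope complex_scope.
Local Open Scope classical_set_scope.
Local Open Scope ring_scope.

(* A model M of T^A is a Hilbert space in disguise: the brackets [x, y] + i [x, iy]
   form a positive definite kernel on the disjoint union of the sorts, whose
   reproducing kernel Hilbert space E (functions on the elements of M) carries the
   representation (p a f) y = f (pi_{a*} y).  Each sort is a complete, hence closed,
   subset of E, stable under multiplication by scalars of [0, 1].  (BallImg) sends
   p a of the unit sphere, hence of the unit ball, into S_a; conversely a is close
   to some a b with |b| <= 1, so that by (HausDist) and (DenseImg) S_a is
   approximated by p a (S_b), and S_b lies in the unit ball.  Two non-degenerate
   representations with the same structure have total families with the same Gram
   matrix, whence a unitary between them.  For the axiomatization, (Conv) is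
   replaced by the two identities d(x, y) = 2 d((x - y) / 2, 0) and
   (x - x) / 2 = 0, which suffice to build E. *)

(** The brackets live on pairs of elements, and a non-trivial combination of elements may be null.
    Realising vectors as functions of an element avoids both a quotient and a completion: a null
    combination is the zero function, limits are pointwise limits, and an operator given by
    composition needs no check of well-definedness. The obstacle is scalars: apart from the scaling
    part of (Pi2), the axioms speak of plain sums, whereas E is complex. Midpoints and completeness
    give multiples by scalars of [0, 1] inside a sort; repetition, negation and [i] then turn every
    complex combination into a plain sum, so that (Pos), (Pi1) and (BallImg) reach all of E. (Conv)
    asserts the existence of a Banach space, which is not a formula. Weakening it loses nothing:
    with the other axioms and the assumption on A, the two identities already force the structure to
    be some M(E, p), and every M(E, p) satisfies (Conv). *)

Section ComplexAux.
Variable R : realType.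
Implicit Types z w : R[i].

Definition cabs z : R := complex.Re `|z|.

Lemma cabsE z : `|z| = (cabs z)%:C.
Proof. by rewrite /cabs RRe_real// ger0_real. Qed.

Lemma cabs_ge0 z : 0 <= cabs z.
Proof. by have := normr_ge0 z; rewrite lecE => /andP[]. Qed.

Lemma cabsM z w : cabs (z * w) = cabs z * cabs w.
Proof. by apply: complexI; rewrite rmorphM -!cabsE normrM. Qed.

Lemma cabsV z : cabs z^-1 = (cabs z)^-1.
Proof. by apply: complexI; rewrite fmorphV/= -!cabsE normfV. Qed.

Lemma ler_cabsD z w : cabs (z + w) <= cabs z + cabs w.
Proof. by rewrite -lecR rmorphD/= -!cabsE ler_normD. Qed.

Lemma cabsN z : cabs (- z) = cabs z.
Proof. by rewrite /cabs normrN. Qed.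

Lemma cabs_conj z : cabs z^* = cabs z.
Proof. by rewrite /cabs normcJ. Qed.

Lemma cabs0 : cabs 0 = 0.
Proof. by rewrite /cabs normr0. Qed.

Lemma cabs_real (r : R) : cabs r%:C = `|r|.
Proof. by rewrite /cabs normc_def/= expr0n addr0 sqrtr_sqr. Qed.

Lemma cabs1 : cabs 1 = 1.
Proof. by rewrite /cabs normr1. Qed.

Lemma cabs_ReIm z : cabs z <= `|complex.Re z| + `|complex.Im z|.
Proof.
rewrite {1}[z]complexE (le_trans (ler_cabsD _ _))//.
by rewrite cabsM !cabs_real [cabs 'i]Re_normC_i mul1r.
Qed.

Lemma cabs_eq0 z : cabs z = 0 -> z = 0.
Proof. by move=> z0; apply/eqP; rewrite -normr_eq0 cabsE z0. Qed.

Lemma Re_le_cabs z : complex.Re z <= cabs z.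
Proof. by rewrite -lecR -cabsE; apply: le_trans (normc_ge_Re z); rewrite lecR ler_norm. Qed.

Lemma normr_Re_le z : `|complex.Re z| <= cabs z.
Proof. by rewrite -lecR -cabsE normc_ge_Re. Qed.

Lemma normr_Im_le z : `|complex.Im z| <= cabs z.
Proof.
by have := normr_Re_le (z * 'i%C); rewrite ReiNIm normrN cabsM [cabs 'i]Re_normC_i mulr1.
Qed.

Lemma ReD z w : complex.Re (z + w) = complex.Re z + complex.Re w.
Proof. by case: z w => ? ? []. Qed.

Lemma ReN z : complex.Re (- z) = - complex.Re z.
Proof. by case: z. Qed.

Lemma Re_conj z : complex.Re z^* = complex.Re z.
Proof. by case: z. Qed.

Lemma ReZ (r : R) z : complex.Re (r%:C * z) = r * complex.Re z.
Proof. by case: z => a b /=; rewrite mul0r subr0. Qed.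

Lemma conjcM z w : (z * w)^* = z^* * w^*.
Proof. exact: rmorphM. Qed.

Lemma conjc_sum J (r : seq J) (F : J -> R[i]) :
  (\sum_(j <- r) F j)^* = \sum_(j <- r) (F j)^*.
Proof. exact: rmorph_sum. Qed.

Lemma conjcR (r : R) : (r%:C)^* = r%:C.
Proof. exact: conjc_real. Qed.

Lemma conjM_cabs z : z * z^* = (cabs z ^+ 2)%:C.
Proof. by rewrite -sqr_normc cabsE rmorphXn. Qed.

(** A non-negative quadratic polynomial has a non-positive discriminant. This is the core of
    Cauchy-Schwarz for a form that may be degenerate, whence the case [c = 0]. *)
Lemma discr_le (a b c : R) : 0 <= a -> 0 <= c ->
  (forall r : R, 0 <= a + 2 * r * b + r ^+ 2 * c) -> b <= Num.sqrt a * Num.sqrt c.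
Proof.
move=> a0 c0 H; rewrite -sqrtrM//.
suff : b ^+ 2 <= a * c.
  by move=> /ler_wsqrtr; rewrite sqrtr_sqr; apply: le_trans; exact: ler_norm.
have [c_eq0|cN0] := eqVneq c 0.
  rewrite c_eq0 mulr0 leNgt; apply/negP => b2.
  have bN0 : b != 0 by apply: contraTneq b2 => ->; rewrite expr0n ltxx.
  (* With [c = 0] the polynomial is affine in [r], and takes the value -1 at this point. *)
  have := H (- (a + 1) / (2 * b)); rewrite c_eq0 mulr0 addr0.
  have -> : 2 * (- (a + 1) / (2 * b)) * b = - (a + 1) by field.
  lra.
have cp : 0 < c by rewrite lt_neqAle eq_sym cN0.
have := H (- b / c).
have -> : a + 2 * (- b / c) * b + (- b / c) ^+ 2 * c = (a * c - b ^+ 2) / c by field.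
by rewrite pmulr_lge0 ?invr_gt0// subr_ge0.
Qed.

End ComplexAux.

(** * Reproducing kernel Hilbert spaces *)

Section LinComb.
Variables (R : realType) (I : Type).
Implicit Types (K : I -> I -> R[i]) (s t : seq (R[i] * I)) (f g : I -> R[i]) (z : R[i]).

Definition lcomb K s : I -> R[i] := fun y => \sum_(x <- s) x.1 * K x.2 y.
(** By the reproducing property this is the inner product of [f] with [lcomb K t], written before
    any inner product exists. *)
Definition lpair f t : R[i] := \sum_(y <- t) (y.1)^* * f y.2.
Definition lscale z s := [seq (z * x.1, x.2) | x <- s].

Lemma lpair_cat f s t : lpair f (s ++ t) = lpair f s + lpair f t.
Proof. exact: big_cat. Qed.

Lemma lpair_scale f z t : lpair f (lscale z t) = z^* * lpair f t.
Proof.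
rewrite /lpair big_map mulr_sumr; apply: eq_bigr => x _ /=.
by rewrite rmorphM mulrA.
Qed.

Lemma lpairD f g t : lpair (f + g) t = lpair f t + lpair g t.
Proof. by rewrite -big_split; apply: eq_bigr => x _; rewrite /= -mulrDr. Qed.

Lemma lpairZ z f t : lpair (z *: f) t = z * lpair f t.
Proof.
by rewrite /lpair mulr_sumr; apply: eq_bigr => x _ /=; rewrite mulrCA.
Qed.

Lemma lpair1 f y : lpair f [:: (1, y)] = f y.
Proof. by rewrite /lpair big_seq1/= rmorph1 mul1r. Qed.

Lemma lcomb_cat K s t : lcomb K (s ++ t) = lcomb K s + lcomb K t.
Proof. by apply/funext => y; exact: big_cat. Qed.

Lemma lcomb_scale K z s : lcomb K (lscale z s) = z *: lcomb K s.
Proof.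
apply/funext => y; transitivity (z * lcomb K s y); last by [].
rewrite /lcomb big_map mulr_sumr.
by apply: eq_bigr => x _; rewrite mulrA.
Qed.

Lemma lcomb_nil K : lcomb K [::] = 0.
Proof. by apply/funext => y; rewrite /lcomb big_nil. Qed.

End LinComb.

Record pd_kernel (R : realType) (I : Type) := PdKernel {
  kfun :> I -> I -> R[i];
  kfunC : forall x y, kfun y x = (kfun x y)^*;
  kfun_ge0 : forall s, 0 <= complex.Re (lpair (lcomb kfun s) s)
}.

Section KernelForm.
Variables (R : realType) (I : Type) (K : pd_kernel R I).
Implicit Types (s t : seq (R[i] * I)) (f g : I -> R[i]) (z : R[i]) (c d e : R).

Definition kform s t := lpair (lcomb K s) t.

Lemma kformC s t : kform t s = (kform s t)^*.
Proof.
rewrite /kform /lpair conjc_sum /lcomb.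
under eq_bigr do rewrite mulr_sumr.
under [RHS]eq_bigr do rewrite conjcM conjc_sum mulr_sumr.
rewrite exchange_big/=; apply: eq_bigr => x _; apply: eq_bigr => y _.
by rewrite conjcM (kfunC K x.2) !conjCK mulrCA.
Qed.

Lemma kform_catl s s' t : kform (s ++ s') t = kform s t + kform s' t.
Proof. by rewrite /kform lcomb_cat lpairD. Qed.

Lemma kform_catr s t t' : kform s (t ++ t') = kform s t + kform s t'.
Proof. exact: lpair_cat. Qed.

Lemma kform_scalel z s t : kform (lscale z s) t = z * kform s t.
Proof. by rewrite /kform lcomb_scale lpairZ. Qed.

Lemma kform_scaler z s t : kform s (lscale z t) = z^* * kform s t.
Proof. exact: lpair_scale. Qed.

Lemma kform_real s : kform s s = (complex.Re (kform s s))%:C.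
Proof.
have := kformC s s; case: (kform s s) => a b [] /= bN.
by congr (_ +i* _); lra.
Qed.

Definition knorm s : R := Num.sqrt (complex.Re (kform s s)).

Lemma knorm_ge0 s : 0 <= knorm s. Proof. exact: sqrtr_ge0. Qed.

Lemma knorm_sqr s : knorm s ^+ 2 = complex.Re (kform s s).
Proof. by rewrite sqr_sqrtr// kfun_ge0. Qed.

Lemma knorm_scale z s : knorm (lscale z s) = cabs z * knorm s.
Proof.
rewrite /knorm kform_scalel kform_scaler mulrA conjM_cabs ReZ.
by rewrite sqrtrM ?sqr_ge0// sqrtr_sqr ger0_norm// cabs_ge0.
Qed.

Lemma Re_kform_le s t : complex.Re (kform s t) <= knorm s * knorm t.
Proof.
apply: discr_le; [exact: kfun_ge0|exact: kfun_ge0|move=> r].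
have := kfun_ge0 K (s ++ lscale r%:C t); rewrite -/(kform _ _).
rewrite kform_catl !kform_catr !kform_scalel !kform_scaler conjcR.
rewrite (kformC s t) !ReD !ReZ Re_conj; congr (0 <= _); ring.
Qed.

Lemma kform_le s t : cabs (kform s t) <= knorm s * knorm t.
Proof.
have [->|k0] := eqVneq (cabs (kform s t)) 0; first by rewrite mulr_ge0 ?knorm_ge0.
(* The phase that rotates [kform s t] onto the non-negative reals, where the bound on real parts
   applies. *)
pose u := (kform s t)^* / (cabs (kform s t))%:C.
have uk : u * kform s t = (cabs (kform s t))%:C.
  rewrite /u mulrAC [_^* * _]mulrC conjM_cabs expr2 rmorphM mulfK//.
  by apply: contra_neq k0 => /(congr1 (@complex.Re R)).
have := Re_kform_le (lscale u s) t; rewrite kform_scalel uk/= knorm_scale.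
suff -> : cabs u = 1 by rewrite mul1r.
by rewrite /u cabsM cabs_conj -fmorphV cabs_real ger0_norm ?invr_ge0 ?cabs_ge0// mulfV.
Qed.

(** The dual norm of the antilinear functional [lpair f] on formal combinations is at most [c]; in
    particular the functional kills null combinations. *)
Definition kbound f c := forall t, cabs (lpair f t) <= c * knorm t.

(* The reproducing kernel Hilbert space of K: the functions that the
   combinations of the [K x], x in I, approximate uniformly on the unit ball. *)
Definition rkhs_mem f := forall e, 0 < e -> exists s, kbound (f - lcomb K s) e.

Lemma kboundD f g c d : kbound f c -> kbound g d -> kbound (f + g) (c + d).
Proof.
move=> fc gd t; rewrite lpairD mulrDl.
by rewrite (le_trans (ler_cabsD _ _))// lerD.
Qed.

Lemma kboundZ z f c : kbound f c -> kbound (z *: f) (cabs z * c).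
Proof. by move=> fc t; rewrite lpairZ cabsM -mulrA ler_wpM2l// cabs_ge0. Qed.

Lemma kbound_le f c d : c <= d -> kbound f c -> kbound f d.
Proof.
by move=> cd fc t; apply: le_trans (fc t) _; rewrite ler_wpM2r ?knorm_ge0.
Qed.

Lemma kbound_lcomb s : kbound (lcomb K s) (knorm s).
Proof. exact: kform_le. Qed.

Lemma kbound0 : kbound 0 0.
Proof.
by move=> t; rewrite mul0r /lpair big1 ?cabs0// => x _ /=; rewrite mulr0.
Qed.

Lemma rkhs_mem_lcomb s : rkhs_mem (lcomb K s).
Proof.
move=> e e0; exists s; rewrite subrr; exact: kbound_le (ltW e0) kbound0.
Qed.

Lemma rkhs_mem_bound f : rkhs_mem f -> exists2 c, 0 <= c & kbound f c.
Proof.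
move=> /(_ 1 ltr01)[s sP]; exists (1 + knorm s).
  by rewrite addr_ge0// knorm_ge0.
by rewrite -(subrK (lcomb K s) f); apply: kboundD => //; exact: kbound_lcomb.
Qed.

Definition rkhs_pred : {pred I -> R[i]} := [pred f | `[< rkhs_mem f >]].

Lemma rkhs_pred_submod : submod_closed rkhs_pred.
Proof.
split.
  by apply/asboolP; rewrite -(lcomb_nil K); exact: rkhs_mem_lcomb.
move=> z f g /asboolP fE /asboolP gE; apply/asboolP => e e0.
have z1 : 0 < cabs z + 1 by rewrite ltr_wpDl ?cabs_ge0.
have [|s sP] := fE (e / 2 / (cabs z + 1)); first by rewrite !divr_gt0.
have [|t tP] := gE (e / 2); first by rewrite divr_gt0.
exists (lscale z s ++ t).
rewrite lcomb_cat lcomb_scale opprD addrACA -scalerBr.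
apply: (@kbound_le _ (cabs z * (e / 2 / (cabs z + 1)) + e / 2)).
  rewrite [leRHS]splitr lerD2r mulrA ler_pdivrMr// mulrC.
  by rewrite ler_wpM2l ?lerDl// ltW// divr_gt0.
by apply: kboundD => //; exact: kboundZ.
Qed.

End KernelForm.

Section Rkhs.
Variables (R : realType) (I : Type) (K : pd_kernel R I).

HB.instance Definition _ := GRing.isSubmodClosed.Build R[i] (I -> R[i])
  (rkhs_pred K) (rkhs_pred_submod K).

Record rkhs := Rkhs { rkhs_fun :> I -> R[i]; rkhs_funP : rkhs_fun \in rkhs_pred K }.

HB.instance Definition _ := [isSub for rkhs_fun].
HB.instance Definition _ := [Choice of rkhs by <:].
HB.instance Definition _ := [SubChoice_isSubLmodule of rkhs by <:].

Implicit Types (f g h : rkhs) (s t : seq (R[i] * I)) (z : R[i]) (c e : R).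

Lemma rkhs_funB f g : rkhs_fun (f - g) = rkhs_fun f - rkhs_fun g.
Proof. by []. Qed.

Lemma rkhs_memP f : rkhs_mem K f.
Proof. exact/asboolP/(rkhs_funP f). Qed.

(** The condition [0 <= c] matters when every combination is null: all negative [c] would then be
    bounds, and the infimum a default value. *)
Definition rkhs_bounds f : set R := [set c | 0 <= c /\ kbound K f c].
Definition rkhs_rnorm f : R := inf (rkhs_bounds f).

Lemma rkhs_bounds_has_inf f : has_inf (rkhs_bounds f).
Proof.
split; last by exists 0 => c [].
by have [c c0 fc] := rkhs_mem_bound (rkhs_memP f); exists c.
Qed.

Lemma rkhs_rnorm_ge0 f : 0 <= rkhs_rnorm f.
Proof.
by apply: lb_le_inf; [case: (rkhs_bounds_has_inf f)|move=> c []].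
Qed.

Lemma rkhs_rnorm_le f c : 0 <= c -> kbound K f c -> rkhs_rnorm f <= c.
Proof.
by move=> c0 fc; apply: ge_inf; [case: (rkhs_bounds_has_inf f)|split].
Qed.

Lemma rkhs_rnorm_bound f : kbound K f (rkhs_rnorm f).
Proof.
(* The infimum is attained: on a null combination any bound already gives 0, and elsewhere one
   divides by [knorm K t]. *)
move=> t; have [t0|tN0] := eqVneq (knorm K t) 0.
  have [c _ fc] := rkhs_mem_bound (rkhs_memP f).
  by have := fc t; rewrite t0 !mulr0.
have tp : 0 < knorm K t by rewrite lt_neqAle eq_sym tN0 knorm_ge0.
rewrite -ler_pdivrMr//; apply: lb_le_inf; first by case: (rkhs_bounds_has_inf f).
by move=> c [_ fc]; rewrite ler_pdivrMr.
Qed.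

Definition rkhs_norm f : R[i] := (rkhs_rnorm f)%:C.

Lemma rkhs_normD f g : rkhs_norm (f + g) <= rkhs_norm f + rkhs_norm g.
Proof.
rewrite -rmorphD lecR; apply: rkhs_rnorm_le.
  by rewrite addr_ge0// rkhs_rnorm_ge0.
by apply: kboundD; exact: rkhs_rnorm_bound.
Qed.

Let rkhs_normZ_le z f : rkhs_rnorm (z *: f) <= cabs z * rkhs_rnorm f.
Proof.
apply: rkhs_rnorm_le; first by rewrite mulr_ge0 ?cabs_ge0 ?rkhs_rnorm_ge0.
by apply: kboundZ; exact: rkhs_rnorm_bound.
Qed.

Lemma rkhs_normZ z f : rkhs_norm (z *: f) = `|z| * rkhs_norm f.
Proof.
rewrite cabsE -rmorphM; congr _%:C; apply/eqP; rewrite eq_le rkhs_normZ_le/=.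
have [->|z0] := eqVneq z 0; first by rewrite cabs0 mul0r rkhs_rnorm_ge0.
have zp : 0 < cabs z.
  rewrite lt_neqAle cabs_ge0 andbT eq_sym.
  by apply: contra_neq z0; exact: cabs_eq0.
have := rkhs_normZ_le z^-1 (z *: f).
by rewrite scalerA mulVf// scale1r cabsV ler_pdivlMl.
Qed.

Lemma rkhs_norm0_eq0 f : rkhs_norm f = 0 -> f = 0.
Proof.
move=> /(congr1 (@complex.Re R))/= f0; apply/val_inj/funext => x /=.
have := rkhs_rnorm_bound f [:: (1, x)].
rewrite f0 mul0r lpair1 => H; apply: cabs_eq0; apply/eqP.
by rewrite eq_le H cabs_ge0.
Qed.

HB.instance Definition _ := Lmodule_isNormed.Build R[i] rkhs
  rkhs_normD rkhs_normZ rkhs_norm0_eq0.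

Lemma rnorm_rkhs f : rnorm f = rkhs_rnorm f.
Proof. by []. Qed.

Lemma rkhs_bound f : kbound K f (rnorm f).
Proof. exact: rkhs_rnorm_bound. Qed.

Lemma rkhs_eval_le f x : cabs (f x) <= rnorm f * knorm K [:: (1, x)].
Proof. by rewrite -lpair1 rkhs_bound. Qed.

(** Evaluations are Lipschitz, so a Cauchy filter has a pointwise limit; the work is to make the
    convergence uniform on the unit ball of combinations, which also puts the limit in the space. *)
Let rkhs_complete (F : set_system rkhs) : ProperFilter F -> cauchy F -> cvg F.
Proof.
move=> FF /cauchy_ballP Fc.
have FcP e : 0 < e -> \forall f & g \near F, rnorm (f - g) < e.
  move=> e0; have e0' : 0 < e%:C by rewrite ltcR.
  have [[P Q] /= [FP FQ] PQ] := Fc _ e0'.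
  exists (P, Q) => // -[f g] /= [Pf Qg].
  by have := PQ (f, g) (conj Pf Qg); rewrite -ball_normE/= rnormE ltcR.
(* Real and imaginary parts are taken to their limits separately, in the complete space [R]. *)
have part_cvg (u : R[i] -> R) x :
    (forall z w, `|u z - u w| <= cabs (z - w)) -> cvg (u (rkhs_fun f x) @[f --> F]).
  move=> uL; apply: cauchy_cvg; apply/cauchy_ballP => e e0.
  have n1 : 0 < knorm K [:: (1, x)] + 1 by rewrite ltr_wpDl ?knorm_ge0.
  have [[P Q] /= [FP FQ] PQ] := FcP (e / (knorm K [:: (1, x)] + 1)) (divr_gt0 e0 n1).
  exists ((fun f : rkhs => u (f x)) @` P, (fun f : rkhs => u (f x)) @` Q).
    by split; [apply: filterS FP|apply: filterS FQ] => f Pf; exists f.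
  move=> [_ _] /= [[f Pf <-] [g Qg <-]].
  rewrite -ball_normE/= (le_lt_trans (uL _ _))//.
  rewrite (le_lt_trans (rkhs_eval_le (f - g) x))//.
  have /= fg := PQ (f, g) (conj Pf Qg).
  apply: (@le_lt_trans _ _ (rnorm (f - g) * (knorm K [:: (1, x)] + 1))).
    by rewrite ler_wpM2l ?rnorm_ge0// lerDl.
  by rewrite -ltr_pdivlMr.
pose l x : R[i] :=
  lim (complex.Re (rkhs_fun f x) @[f --> F]) +i* lim (complex.Im (rkhs_fun f x) @[f --> F]).
have eval_l x e : 0 < e -> \forall f \near F, cabs (rkhs_fun f x - l x) < e.
  move=> e0; have e20 : 0 < e / 2 by rewrite divr_gt0.
  have /cvgrPdist_lt/(_ _ e20) Rel : complex.Re (rkhs_fun f x) @[f --> F] --> complex.Re (l x).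
    by apply: part_cvg => z w; rewrite -ReN -ReD normr_Re_le.
  have /cvgrPdist_lt/(_ _ e20) Iml : complex.Im (rkhs_fun f x) @[f --> F] --> complex.Im (l x).
    by apply: part_cvg => -[a b] [c d]; exact: (normr_Im_le ((a +i* b) - (c +i* d))).
  near=> f; rewrite -cabsN opprB (le_lt_trans (cabs_ReIm _))// [ltRHS]splitr ltrD//.
    by rewrite ReD ReN; near: f.
  have -> : complex.Im (l x - f x) = complex.Im (l x) - complex.Im (f x).
    by case: (l x) (f x) => ? ? [].
  by near: f.
have pair_l t e : 0 < e -> \forall f \near F, cabs (lpair (rkhs_fun f - l) t) < e.
  elim: t e => [|y t IH] e e0.
    by near=> f; rewrite /lpair big_nil cabs0.
  have e20 : 0 < e / 2 by rewrite divr_gt0.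
  have y1 : 0 < cabs y.1 + 1 by rewrite ltr_wpDl ?cabs_ge0.
  near=> f; rewrite /lpair big_cons (le_lt_trans (ler_cabsD _ _))// [ltRHS]splitr ltrD//.
    rewrite cabsM cabs_conj.
    apply: (@le_lt_trans _ _ ((cabs y.1 + 1) * cabs (f y.2 - l y.2))).
      by rewrite ler_wpM2r ?cabs_ge0// lerDl.
    rewrite mulrC -ltr_pdivlMr//; near: f; apply: eval_l; exact: divr_gt0.
  by near: f; exact: IH.
(* The function [g] used for comparison depends on the combination [t] and on the slack [d], but the
   bound on [f - g] does not: this gives uniformity in [t]. *)
have bound_l e : 0 < e -> \forall f \near F, kbound K (rkhs_fun f - l) e.
  move=> e0; have [[P Q] /= [FP FQ] PQ] := FcP e e0.
  apply: filterS FP => f Pf t; apply/ler_addgt0Pr => d d0.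
  have [g [Qg gl]] := filter_ex (filterI FQ (pair_l t d d0)).
  have -> : rkhs_fun f - l = rkhs_fun (f - g) + (rkhs_fun g - l).
    by rewrite rkhs_funB addrA subrK.
  rewrite lpairD (le_trans (ler_cabsD _ _))// lerD ?(ltW gl)//.
  rewrite (le_trans (rkhs_bound (f - g) t))// ler_wpM2r ?knorm_ge0//.
  by rewrite ltW//; exact: (PQ (f, g) (conj Pf Qg)).
have l_mem : l \in rkhs_pred K.
  apply/asboolP => e e0; have e20 : 0 < e / 2 by rewrite divr_gt0.
  have [f fl] := filter_ex (bound_l _ e20).
  have [s sP] := rkhs_memP f e20.
  exists s; have -> : l - lcomb K s = (-1) *: (rkhs_fun f - l) + (rkhs_fun f - lcomb K s).
    by rewrite scaleN1r opprB addrA subrK.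
  rewrite [e]splitr; apply: kboundD => //.
  by have := kboundZ (-1) fl; rewrite cabsN cabs1 mul1r.
apply/cvg_ex; exists (Rkhs l_mem); apply/cvgrPdist_le => e e0.
have eE : (complex.Re e)%:C = e by rewrite RRe_real// gtr0_real.
have e0' : 0 < complex.Re e by rewrite -ltcR eE.
apply: filterS (bound_l _ e0') => f fl; rewrite distrC rnormE -eE lecR rnorm_rkhs.
by apply: rkhs_rnorm_le; rewrite ?ltW.
Unshelve. all: by end_near. Qed.

HB.instance Definition _ := Uniform_isComplete.Build rkhs rkhs_complete.

Definition rkhs_lcomb s : rkhs := Rkhs (introT (asboolP _) (rkhs_mem_lcomb K s)).

End Rkhs.

Lemma cvg_rnormP (R : realType) (V : normedModType R[i]) (T : Type)
    (F : set_system T) {FF : Filter F} (u : T -> V) (f : V) :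
  u @ F --> f <-> forall e : R, 0 < e -> \forall x \near F, rnorm (f - u x) < e.
Proof.
split=> [/cvgrPdist_lt uf e e0|uf].
  have e0' : 0 < e%:C by rewrite ltcR.
  by apply: filterS (uf _ e0') => x; rewrite rnormE ltcR.
apply/cvgrPdist_lt => e e0.
have eE : (complex.Re e)%:C = e by rewrite RRe_real// gtr0_real.
have e0' : 0 < complex.Re e by rewrite -ltcR eE.
by apply: filterS (uf _ e0') => x; rewrite rnormE -eE ltcR.
Qed.

Lemma cvg_bounded_additive (R : realType) (V W : normedModType R[i])
    (v : V -> W) (c : R) (f_ : nat -> V) (f : V) :
  0 <= c -> {morph v : x y / x - y} -> (forall x, rnorm (v x) <= c * rnorm x) ->
  f_ n @[n --> \oo] --> f -> v (f_ n) @[n --> \oo] --> v f.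
Proof.
move=> c0 vB vc /cvg_rnormP ff; apply/cvg_rnormP => e e0.
(* Dividing by [c + 1] covers the case [c = 0]. *)
have c1 : 0 < c + 1 by rewrite ltr_wpDl.
near=> n; have fn : rnorm (f - f_ n) < e / (c + 1).
  by near: n; apply: ff; exact: divr_gt0.
rewrite -vB (le_lt_trans (vc _))//.
apply: (@le_lt_trans _ _ ((c + 1) * rnorm (f - f_ n))).
  by rewrite ler_wpM2r ?rnorm_ge0// lerDl.
by rewrite mulrC -ltr_pdivlMr.
Unshelve. all: by end_near. Qed.

(** * Polarization: the inner product as a continuous function of the norm *)

Section Polarization.
Variables (R : realType) (V : normedModType R[i]).
Implicit Types (f g h : V) (z : R[i]).

Lemma cvg_dense_rnorm (T : Type) (u : T -> V) f :
  (forall e : R, 0 < e -> exists t, rnorm (f - u t) < e) ->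
  exists t : nat -> T, u (t n) @[n --> \oo] --> f.
Proof.
move=> H; have /choice[t tP] : forall n, exists t, rnorm (f - u t) < n.+1%:R^-1.
  by move=> n; apply: H; rewrite invr_gt0.
exists t; apply/cvg_rnormP => e e0.
near=> n; rewrite (lt_trans (tP n))//.
near: n; exact: near_infty_natSinv_lt (PosNum e0).
Unshelve. all: by end_near. Qed.

(** Defined in a bare normed space, so that it can serve as the definition of the inner product of
    [rkhs]. Its continuity carries identities from a dense set to the whole space. *)
Definition polar f g : R[i] := 4^-1 *
  (`|f + g| ^+ 2 - `|f - g| ^+ 2 +
   'i * (`|f + 'i *: g| ^+ 2 - `|f - 'i *: g| ^+ 2)).

Lemma polarC f g : polar f g = (polar g f)^*.
Proof.
have conjn h : `|h|^* = `|h| by rewrite rnormE conjcR.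
have ni h : `|'i *: h| = `|h| by rewrite normrZ cabsE [cabs _]Re_normC_i mul1r.
have i2 : 'i * 'i = -1 :> R[i] by rewrite -expr2 sqr_i.
(* Multiplication by ['i] is isometric; exchanging [f] and [g] therefore swaps the last two norms,
   which changes the sign of the imaginary part. *)
have e1 : `|g - 'i *: f| = `|f + 'i *: g|.
  by rewrite -[LHS]ni scalerBr scalerA i2 scaleN1r opprK addrC.
have e2 : `|g + 'i *: f| = `|f - 'i *: g|.
  by rewrite -[LHS]ni scalerDr scalerA i2 scaleN1r distrC.
rewrite /polar [g + f]addrC [`|g - f|]distrC e1 e2.
have conjN w : (- w)^* = - w^* :> R[i] by exact: rmorphN.
have conjD w v : (w + v)^* = w^* + v^* :> R[i] by exact: rmorphD.
rewrite !(conjcM, conjD, conjN) !conjn.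
have -> : ('i^* : R[i]) = - 'i by apply/eqP; rewrite eq_complex /= oppr0 !eqxx.
have -> : (4^-1 : R[i])^* = 4^-1.
  have -> : (4^-1 : R[i]) = (4^-1)%:C by rewrite fmorphV rmorph_nat.
  exact: conjcR.
ring.
Qed.

Lemma polarE f : polar f f = `|f| ^+ 2.
Proof.
have ni h : `|'i *: h| = `|h| by rewrite normrZ cabsE [cabs _]Re_normC_i mul1r.
have i2 : 'i * 'i = -1 :> R[i] by rewrite -expr2 sqr_i.
rewrite /polar subrr normr0 expr0n/= subr0 -[`|f - _|]ni scalerBr scalerA i2.
rewrite scaleN1r opprK (addrC ('i *: f)) subrr mulr0 addr0.
rewrite -[f + f]/(f *+ 2) -[f *+ 2]scaler_nat normrZ.
by rewrite ger0_norm// exprMn; field.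
Qed.

Lemma cvg_polar (f_ g_ : nat -> V) f g :
  f_ n @[n --> \oo] --> f -> g_ n @[n --> \oo] --> g ->
  polar (f_ n) (g_ n) @[n --> \oo] --> (polar f g : R[i]^o).
Proof.
move=> ff gg; apply: cvgMl_tmp.
have sq (u_ : nat -> V) u : u_ n @[n --> \oo] --> u ->
    `|u_ n| ^+ 2 @[n --> \oo] --> (`|u| ^+ 2 : R[i]^o).
  by move=> uu; rewrite expr2; under eq_cvg do rewrite expr2;
     apply: cvgM; exact: cvg_norm.
apply: cvgD.
  by apply: cvgD; [|apply: cvgN]; apply: sq; apply: cvgD => //; exact: cvgN.
apply: cvgMl_tmp; apply: cvgD; [|apply: cvgN]; apply: sq; apply: cvgD => //;
  [|apply: cvgN]; exact: cvgZl_tmp.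
Qed.

(** The values at 1, -1, ['i] and [- 'i] isolate the coefficient [b]. Only the expansion of the norm
    along [f + z *: g] is assumed, so the lemma applies both to a given inner product and to the
    form of a kernel. *)
Lemma polar_sesquilinear f g (a b c d : R[i]) :
  (forall z, `|f + z *: g| ^+ 2 = a + z^* * b + z * c + z * z^* * d) ->
  polar f g = b.
Proof.
move=> nE; have := (nE 1, nE (-1), nE 'i, nE (- 'i)).
rewrite !scale1r !scaleNr !scale1r /polar => -[[[-> ->] ->] ->].
have conjN w : (- w)^* = - w^* :> R[i] by exact: rmorphN.
rewrite !conjN (_ : 1^* = 1); last exact: rmorph1.
have -> : ('i^* : R[i]) = - 'i by apply/eqP; rewrite eq_complex /= oppr0 !eqxx.
have i2 : 'i * 'i = -1 :> R[i] by rewrite -expr2 sqr_i.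
move: i2; set j : R[i] := 'i => i2.
transitivity (4^-1 * (2 * b + 2 * c - 2 * (j * j) * b + 2 * (j * j) * c)).
  by field.
by rewrite i2; field.
Qed.

End Polarization.

Lemma inner_polar (R : realType) (E : hilbertType R) (f g : E) : inner f g = polar f g.
Proof.
symmetry.
apply: (@polar_sesquilinear _ _ _ _ (inner f f) _ (inner g f) (inner g g)) => z.
rewrite normE_inner linearDl !linearDr/= !linearZl_LR/= !linearZr_LR/=.
by rewrite /GRing.scale/=; ring.
Qed.

Section RkhsInner.
Variables (R : realType) (I : Type) (K : pd_kernel R I).
Implicit Types (f g h : rkhs K) (s t : seq (R[i] * I)) (z : R[i]) (c e : R).

Lemma rkhs_lcomb_cat s t : rkhs_lcomb K (s ++ t) = rkhs_lcomb K s + rkhs_lcomb K t.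
Proof. by apply: val_inj; exact: lcomb_cat. Qed.

Lemma rkhs_lcomb_scale z s : rkhs_lcomb K (lscale z s) = z *: rkhs_lcomb K s.
Proof. by apply: val_inj; exact: lcomb_scale. Qed.

(** Cauchy-Schwarz bounds the dual norm from above; testing the functional on [s] itself gives
    equality. *)
Lemma rnorm_rkhs_lcomb s : rnorm (rkhs_lcomb K s) = knorm K s.
Proof.
apply/eqP; rewrite eq_le; apply/andP; split.
  by apply: rkhs_rnorm_le; [exact: knorm_ge0|exact: kbound_lcomb].
have [->|sN0] := eqVneq (knorm K s) 0; first exact: rnorm_ge0.
have sp : 0 < knorm K s by rewrite lt_neqAle eq_sym sN0 knorm_ge0.
rewrite -(ler_pM2r sp) -expr2 knorm_sqr.
exact: le_trans (Re_le_cabs _) (rkhs_bound (rkhs_lcomb K s) s).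
Qed.

Lemma rkhs_lcomb_dense f e : 0 < e -> exists s, rnorm (f - rkhs_lcomb K s) < e.
Proof.
move=> e0; have e20 : 0 < e / 2 by rewrite divr_gt0.
have [s sP] := rkhs_memP f e20; exists s.
apply: (@le_lt_trans _ _ (e / 2)); last by rewrite ltr_pdivrMr// ltr_pMr// ltr1n.
by apply: rkhs_rnorm_le; rewrite ?ltW.
Qed.

Lemma rkhs_lcomb_cvg f :
  exists s : nat -> seq (R[i] * I), rkhs_lcomb K (s n) @[n --> \oo] --> f.
Proof.
by apply: cvg_dense_rnorm; exact: rkhs_lcomb_dense.
Qed.

Lemma polar_lcomb s t : polar (rkhs_lcomb K s) (rkhs_lcomb K t) = kform K s t.
Proof.
have nE z : `|rkhs_lcomb K s + z *: rkhs_lcomb K t| ^+ 2 =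
    kform K s s + z^* * kform K s t + z * kform K t s + z * z^* * kform K t t.
  rewrite -rkhs_lcomb_scale -rkhs_lcomb_cat rnormE rnorm_rkhs_lcomb.
  rewrite -rmorphXn/= knorm_sqr -kform_real.
  rewrite kform_catl !kform_catr !kform_scalel !kform_scaler; ring.
exact: polar_sesquilinear nE.
Qed.

Definition rkhs_inner : rkhs K -> rkhs K -> R[i] := @polar R (rkhs K).

(** On combinations [polar] is the sesquilinear [kform]; density and continuity of [polar] do the
    rest. *)
Lemma rkhs_inner_linear g : scalar (rkhs_inner ^~ g).
Proof.
rewrite /rkhs_inner => z f f'.
have [s sf] := rkhs_lcomb_cvg f.
have [s' sf'] := rkhs_lcomb_cvg f'.
have [t tg] := rkhs_lcomb_cvg g.
apply: (@cvg_unique R[i]^o _ (polar (z *: rkhs_lcomb K (s n) + rkhs_lcomb K (s' n))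
    (rkhs_lcomb K (t n)) @[n --> \oo])) => //.
  by apply: cvg_polar => //; apply: cvgD => //; exact: cvgZl_tmp.
rewrite (_ : (fun n => _) = (fun n => z * polar (rkhs_lcomb K (s n)) (rkhs_lcomb K (t n))
    + polar (rkhs_lcomb K (s' n)) (rkhs_lcomb K (t n)))).
  by apply: cvgD; [apply: cvgMl_tmp|]; exact: cvg_polar.
apply/funext => n; rewrite -rkhs_lcomb_scale -rkhs_lcomb_cat !polar_lcomb.
by rewrite kform_catl kform_scalel.
Qed.

Lemma rkhs_inner_bilinear : bilinear_for
  (GRing.Scale.Law.clone _ _ *%R _) (GRing.Scale.Law.clone _ _ (Num.conj \; *%R) _) rkhs_inner.
Proof.
split=> [g|f] z u v /=; first exact: rkhs_inner_linear.
have innerC' h h' : rkhs_inner h h' = (rkhs_inner h' h)^* by exact: polarC.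
by rewrite [LHS]innerC' rkhs_inner_linear rmorphD rmorphM/= (innerC' f u) (innerC' f v).
Qed.

HB.instance Definition _ := bilinear_isBilinear.Build R[i] (rkhs K) (rkhs K) R[i]
  _ _ rkhs_inner rkhs_inner_bilinear.

Lemma rkhs_inner_herm f g :
  rkhs_inner f g = (-1) ^+ false * Num.conj (rkhs_inner g f).
Proof. by rewrite expr0 mul1r; exact: polarC. Qed.

HB.instance Definition _ := isHermitianSesquilinear.Build R[i] (rkhs K) false
  (@Num.conj R[i]) rkhs_inner rkhs_inner_herm.

Lemma rkhs_inner_gt0 f : f != 0 -> 0 < rkhs_inner f f.
Proof. by move=> f0; rewrite /rkhs_inner polarE exprn_gt0// normr_gt0. Qed.

HB.instance Definition _ := isDotProduct.Build R[i] (rkhs K) rkhs_inner rkhs_inner_gt0.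

Lemma rkhs_norm_inner f : `|f| ^+ 2 = rkhs_inner f f.
Proof. exact/esym/polarE. Qed.

HB.instance Definition _ := CompleteNormedModule_isHilbert.Build R (rkhs K)
  rkhs_norm_inner.

Lemma inner_rkhs_lcomb s t :
  inner (rkhs_lcomb K s) (rkhs_lcomb K t) = kform K s t.
Proof. exact: polar_lcomb. Qed.

End RkhsInner.

(** * Realizations of a structure in a Hilbert space *)

Section Realify.
Variables (R : realType) (E : completeNormedModType R[i]).

(** [E] with its scalars restricted to [R] and its norm read in [R]: the real Banach space that
    (Conv) asks for. *)
Definition realify : Type := E.

HB.instance Definition _ := GRing.Zmodule.copy realify E.

Let scale (r : R) (x : realify) : realify := r%:C *: (x : E).

Let scaleA a b x : scale a (scale b x) = scale (a * b) x.
Proof. by rewrite /scale scalerA -rmorphM. Qed.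

Let scale1 : left_id 1 scale.
Proof. by move=> x; rewrite /scale rmorph1 scale1r. Qed.

Let scaleDr : right_distributive scale +%R.
Proof. by move=> r x y; rewrite /scale scalerDr. Qed.

Let scaleDl x : {morph scale^~ x : a b / a + b}.
Proof. by move=> a b; rewrite /scale rmorphD scalerDl. Qed.

HB.instance Definition _ := GRing.Zmodule_isLmodule.Build R realify
  scaleA scale1 scaleDr scaleDl.

Let rnormZ_real (r : R) (x : realify) : rnorm ((r *: x : realify) : E) = `|r| * rnorm (x : E).
Proof. by rewrite [LHS]rnormZ [complex.Re _]cabs_real. Qed.

HB.instance Definition _ := Lmodule_isNormed.Build R realify
  (@ler_rnormD R E) rnormZ_real (@rnorm_eq0 R E).

Let realify_complete (F : set_system realify) : ProperFilter F -> cauchy F -> cvg F.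
Proof.
move=> FF /cauchy_ballP Fc.
have Fc' : cauchy (F : set_system E).
  apply/cauchy_ballP => e e0.
  have eE : (complex.Re e)%:C = e by rewrite RRe_real// gtr0_real.
  have e0' : 0 < complex.Re e by rewrite -ltcR eE.
  have [[P Q] /= FPQ PQ] := Fc _ e0'; exists (P, Q) => // z /PQ.
  by rewrite -!ball_normE/= rnormE -eE ltcR.
have /cvg_ex[l Fl] : cvg (F : set_system E) by exact: cauchy_cvg.
apply/cvg_ex; exists l => B /nbhs_ballP[e /= e0 lB].
have e0' : 0 < e%:C by rewrite ltcR.
apply: filterS (Fl _ (nbhsx_ballx (l : E) e%:C e0')) => x.
by rewrite -ball_normE/= rnormE ltcR => lx; apply: lB; rewrite -ball_normE.
Qed.

HB.instance Definition _ := Uniform_isComplete.Build realify realify_complete.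

End Realify.

Section Realization.
Variables (R : realType) (A : banachStarAlgType R) (M : lstructure (LA A)).
Variables (E : hilbertType R) (p : star_rep A E).

(* An isomorphism of M with M(E, p), seen as a family of maps into E. *)
Record realization (g : forall a, M a -> E) : Prop := Realization {
  rz_sort : forall (a : A) x, rep_sort p a x <-> exists y, g a y = x;
  rz_dist : forall (a : A) (x y : M a), mdist x y = rnorm (g a x - g a y);
  rz_zero : forall a : A, g a (mzero M a) = 0;
  rz_opp : forall (a : A) (x : M a), g a (mopp x) = - g a x;
  rz_mid : forall (a : A) (x y : M a), g a (mmid x y) = 2^-1 *: (g a x + g a y);
  rz_i : forall (a : A) (x : M a), g a (mi x) = 'i%C *: g a x;
  rz_pi : forall (a b : A) (x : M b), g (bmul a b) (mpi a x) = p a (g b x);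
  rz_br : forall (a b : A) (x : M a) (y : M b),
    mbr x y = complex.Re (inner (g a x) (g b y))
}.

Lemma isomorphic_realization :
  isomorphic M (rep_structure p) <-> exists g, realization g.
Proof.
split=> [[h [hbij hd hf hp]]|[g gR]].
  exists (fun a x => rep_val (h a x)); split.
  - move=> a x; split=> [ax|[y <-]]; last exact: rep_valP.
    have [k _ hk] := hbij a.
    by exists (k (RepCarrier ax)); rewrite hk.
  - by move=> a x y; rewrite -(hd a).
  - by move=> a; rewrite /mzero -(hf (LA_zero a)).
  - by move=> a x; rewrite /mopp -(hf (LA_opp a) x _ erefl).
  - by move=> a x y; rewrite /mmid -(hf (LA_mid a) x _ erefl y _ erefl).
  - by move=> a x; rewrite /mi -(hf (LA_i a) x _ erefl).
  - by move=> a b x; rewrite /mpi -(hf (LA_pi a b) x _ erefl).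
  - by move=> a b x y; rewrite /mbr -(hp (a, b) x _ erefl y _ erefl).
have gS a (x : M a) : rep_sort p a (g a x) by apply/(rz_sort gR); exists x.
have ginj a : injective (g a).
  move=> x y xy; apply: mdist_positivity; rewrite (rz_dist gR) xy.
  by rewrite subrr rnorm0.
exists (fun a x => RepCarrier (gS a x)); split.
- move=> a; have /choice[k kP] : forall x : rep_carrier p a, exists y, g a y = x.
    by move=> x; apply/(rz_sort gR); exact: rep_valP.
  exists k => x; first by apply: ginj; rewrite kP.
  by apply: rep_val_inj; rewrite /= kP.
- by move=> a x y; rewrite (rz_dist gR).
- case=> [a|a|a|a|a b] /=.
  + by apply: rep_val_inj; rewrite /= (rz_zero gR).
  + by move=> x _ ->; apply: rep_val_inj; rewrite /= (rz_opp gR).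
  + by move=> x _ -> y _ ->; apply: rep_val_inj; rewrite /= (rz_mid gR).
  + by move=> x _ ->; apply: rep_val_inj; rewrite /= (rz_i gR).
  + by move=> x _ ->; apply: rep_val_inj; rewrite /= (rz_pi gR).
- move=> [a b] /= x _ -> y _ ->; symmetry; exact: (rz_br gR).
Qed.

End Realization.

Section InnerAux.
Variables (R : realType) (E : hilbertType R).
Implicit Types x y z : E.

Definition rinner x y : R := complex.Re (inner x y).

Lemma rinnerDl x y z : rinner (x + y) z = rinner x z + rinner y z.
Proof. by rewrite /rinner linearDl ReD. Qed.

Lemma rinnerDr x y z : rinner x (y + z) = rinner x y + rinner x z.
Proof. by rewrite /rinner linearDr/= ReD. Qed.

Lemma rinnerZl (r : R) x y : rinner (r%:C *: x) y = r * rinner x y.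
Proof. by rewrite /rinner linearZl_LR/= ReZ. Qed.

Lemma rinnerZr (r : R) x y : rinner x (r%:C *: y) = r * rinner x y.
Proof. by rewrite /rinner linearZr_LR/= conjcR ReZ. Qed.

Lemma rinner0l x : rinner 0 x = 0.
Proof. by rewrite /rinner linear0l. Qed.

Lemma rinner0r x : rinner x 0 = 0.
Proof. by rewrite /rinner linear0r. Qed.

Lemma rinner_suml (J : Type) (s : seq J) (F : J -> E) y :
  rinner (\sum_(j <- s) F j) y = \sum_(j <- s) rinner (F j) y.
Proof. by elim/big_rec2: _ => [|j r z _ <-]; rewrite ?rinner0l ?rinnerDl. Qed.

Lemma rinner_sumr (J : Type) (s : seq J) (F : J -> E) x :
  rinner x (\sum_(j <- s) F j) = \sum_(j <- s) rinner x (F j).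
Proof. by elim/big_rec2: _ => [|j r z _ <-]; rewrite ?rinner0r ?rinnerDr. Qed.

Lemma sqrt_rinner x : Num.sqrt (rinner x x) = rnorm x.
Proof. by rewrite /rinner Re_inner_sqr sqrtr_sqr ger0_norm ?rnorm_ge0. Qed.

End InnerAux.

Section RepAux.
Variables (R : realType) (A : banachStarAlgType R) (E : hilbertType R).
Variable p : star_rep A E.

Lemma rep_algD a b x : p (a + b) x = p a x + p b x.
Proof. by have := rep_linear_alg p x 1 a b; rewrite !scale1r. Qed.

Lemma rep_alg0 x : p 0 x = 0.
Proof. by apply: (addIr (p 0 x)); rewrite -rep_algD !add0r. Qed.

Lemma rep_algZ (k : R[i]) a x : p (k *: a) x = k *: p a x.
Proof. by have := rep_linear_alg p x k a 0; rewrite rep_alg0 !addr0. Qed.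

Lemma rep_algB a b x : p (a - b) x = p a x - p b x.
Proof. by rewrite rep_algD -scaleN1r rep_algZ scaleN1r. Qed.

Lemma rep_sum a (J : Type) (s : seq J) (F : J -> E) :
  p a (\sum_(j <- s) F j) = \sum_(j <- s) p a (F j).
Proof. by elim/big_rec2: _ => [|j r z _ <-]; rewrite ?rep0 ?repD. Qed.

Lemma rep_sort_convex a x y (t : R) : 0 <= t -> t <= 1 ->
  rep_sort p a x -> rep_sort p a y ->
  rep_sort p a (t%:C *: x + (1 - t)%:C *: y).
Proof.
move=> t0 t1 /rep_sortP ax /rep_sortP ay; apply/rep_sortP => e e0.
have e20 : 0 < e / 2 by rewrite divr_gt0.
have [[x' x1 xx] [y' y1 yy]] := (ax _ e20, ay _ e20).
have t1' : 0 <= 1 - t by rewrite subr_ge0.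
have nE (r : R) (z : E) : 0 <= r -> rnorm (r%:C *: z) = r * rnorm z.
  by move=> r0; rewrite rnormZ [complex.Re _]cabs_real ger0_norm.
have convE (u v : E) : rnorm (t%:C *: u + (1 - t)%:C *: v) <= t * rnorm u + (1 - t) * rnorm v.
  by rewrite (le_trans (ler_rnormD _ _))// !nE.
exists (t%:C *: x' + (1 - t)%:C *: y').
  by rewrite (le_trans (convE _ _))//; nra.
rewrite repD !repZ opprD addrACA -!scalerBr (le_lt_trans (convE _ _))//.
have := ler_wpM2l t0 (ltW xx); have := ler_wpM2l t1' (ltW yy); lra.
Qed.

Lemma rep_sort_ball a x : rnorm x <= 1 -> rep_sort p a (p a x).
Proof. by move=> x1; apply/rep_sortP => e e0; exists x; rewrite ?subrr ?rnorm0. Qed.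

End RepAux.

Section BracketAsInner.
Variables (R : realType) (A : banachStarAlgType R) (M : lstructure (LA A)).
Variables (E : hilbertType R) (v : elt M -> E).
Hypothesis v_br : forall x y, elt_br x y = rinner (v x) (v y).

(** Only [v_br] is used, so the lemma serves realizations as well as the map [embed], before the
    latter is known to be one. *)
Lemma br_sum_rinner s :
  br_sum s = rinner (\sum_(x <- s) v x) (\sum_(x <- s) v x).
Proof.
rewrite rinner_suml; apply: eq_bigr => x _.
by rewrite rinner_sumr; apply: eq_bigr => y _; exact: v_br.
Qed.

Lemma norm_sum_rinner s : norm_sum s = rnorm (\sum_(x <- s) v x).
Proof. by rewrite /norm_sum br_sum_rinner -sqrt_rinner. Qed.

Lemma norm_comb_rinner s : norm_comb s = rnorm (\sum_(x <- s) x.1%:C *: v x.2).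
Proof.
rewrite -sqrt_rinner rinner_suml; congr Num.sqrt; apply: eq_bigr => x _.
rewrite rinner_sumr; apply: eq_bigr => y _.
by rewrite rinnerZl rinnerZr mulrA v_br.
Qed.

End BracketAsInner.

(** * Realizable structures satisfy the axioms *)

Section RealizationModel.
Variables (R : realType) (A : banachStarAlgType R) (M : lstructure (LA A)).
Variables (E : hilbertType R) (p : star_rep A E) (g : forall a, M a -> E).
Arguments g : clear implicits.
Hypothesis gR : realization p g.

Definition elt_val (x : elt M) : E := g (projT1 x) (projT2 x).

Lemma elt_brE x y : elt_br x y = rinner (elt_val x) (elt_val y).
Proof. exact: (rz_br gR). Qed.

Lemma norm_sumE s : norm_sum s = rnorm (\sum_(x <- s) elt_val x).
Proof. exact: (norm_sum_rinner elt_brE). Qed.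

Lemma realization_inj a : injective (g a).
Proof.
move=> x y xy; apply: mdist_positivity; rewrite (rz_dist gR) xy.
by rewrite subrr rnorm0.
Qed.

Lemma elt_val_inj (x y : elt M) :
  projT1 x = projT1 y -> elt_val x = elt_val y -> x = y.
Proof.
case: x y => [a x] [b y] /= ab; rewrite -ab in y *.
by rewrite /elt_val => /= /realization_inj ->.
Qed.

Lemma elt_val_mk a (x : M a) : elt_val (mkelt x) = g a x. Proof. by []. Qed.

Lemma elt_val_pi a x : elt_val (elt_pi a x) = p a (elt_val x).
Proof. exact: (rz_pi gR). Qed.

Lemma elt_val_opp x : elt_val (elt_opp x) = - elt_val x.
Proof. exact: (rz_opp gR). Qed.

Lemma elt_val_i x : elt_val (elt_i x) = 'i *: elt_val x.
Proof. exact: (rz_i gR). Qed.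

Lemma realization_ball a (x : E) : rnorm x <= 1 -> exists z, g a z = p a x.
Proof. by move=> x1; apply/(rz_sort gR); exact: rep_sort_ball. Qed.

Lemma realization_approx a (x : M a) e : 0 < e ->
  exists2 y, rnorm y <= 1 & rnorm (g a x - p a y) < e.
Proof. by apply: (rep_sortP _ _ _).1; apply/(rz_sort gR); exists x. Qed.

End RealizationModel.

Lemma inf_norm_sum_le (R : realType) (A : banachStarAlgType R) (M : lstructure (LA A))
    (J : Type) (F : J -> seq (elt M)) (c : R) :
  (forall e, 0 < e -> exists z, norm_sum (F z) <= c + e) ->
  inf (range (fun z => norm_sum (F z))) <= c.
Proof.
move=> H; apply/ler_addgt0Pr => e /H[z]; apply: le_trans.
by apply: ge_inf; [exists 0 => _ [y _ <-]; exact: sqrtr_ge0|exists z].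
Qed.

Lemma inf_norm_sum_ge0 (R : realType) (A : banachStarAlgType R) (M : lstructure (LA A))
    (J : Type) (F : J -> seq (elt M)) :
  inhabited J -> 0 <= inf (range (fun z => norm_sum (F z))).
Proof.
move=> [j]; apply: lb_le_inf; first by exists (norm_sum (F j)); exists j.
by move=> _ [y _ <-]; exact: sqrtr_ge0.
Qed.

Lemma realization_model (R : realType) (A : banachStarAlgType R) (M : lstructure (LA A))
    (E : hilbertType R) (p : star_rep A E) (g : forall a, M a -> E) :
  realization p g -> model_TA M.
Proof.
move=> gR; split.
- move=> a; exists (realify E), (g a); split.
  + exact: (rz_dist gR).
  + move=> _ _ l /set_mem[x _ <-] /set_mem[y _ <-]; apply/mem_set => /=.
    have [z zE] : exists z, g a z = l%:num%:C *: g a x + (1 - l%:num)%:C *: g a y.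
      by apply/(rz_sort gR)/rep_sort_convex; rewrite ?ge0 ?le1//;
        apply/(rz_sort gR); [exists x|exists y].
    by exists z.
  + exact: (rz_zero gR).
  + exact: (rz_opp gR).
  + move=> x y; rewrite (rz_mid gR); rewrite /GRing.scale/=.
    by rewrite fmorphV rmorph_nat.
- move=> a x; rewrite (rz_dist gR) (rz_zero gR) subr0.
  by apply: (@rep_sort_rnorm _ _ _ p); apply/(rz_sort gR); exists x.
- by move=> a b x y; rewrite !(rz_br gR) Re_innerC.
- move=> a b x y y'; rewrite !(rz_br gR) (rz_mid gR).
  have -> : (2^-1 : R[i]) = (2^-1)%:C by rewrite fmorphV rmorph_nat.
  by rewrite -/(rinner _ _) rinnerZr rinnerDr mulrC.
- by move=> a b x; rewrite (rz_br gR) (rz_zero gR) linear0r.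
- by move=> a x; rewrite (rz_br gR) (rz_dist gR) (rz_zero gR) subr0 Re_inner_sqr.
- by move=> s; rewrite (br_sum_rinner (elt_brE gR)) /rinner Re_inner_sqr sqr_ge0.
- move=> a s; rewrite !(norm_sumE gR) big_map.
  under eq_bigr do rewrite (elt_val_pi gR).
  by rewrite -rep_sum rep_contractive.
- move=> a b x; rewrite (norm_sumE gR) !big_cons big_nil.
  rewrite !(elt_val_opp gR) !(elt_val_pi gR) rep_algD addr0.
  by rewrite -opprD subrr rnorm0.
- move=> k a x; rewrite (norm_comb_rinner (elt_brE gR)) !big_cons big_nil /=.
  rewrite (elt_val_i gR) !(elt_val_pi gR) rep_algZ addr0 !scalerA -!scalerDl.
  suff -> : 1%:C * k + ((- complex.Re k)%:C + (- complex.Im k)%:C * 'i) = 0.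
    by rewrite scale0r rnorm0.
  by case: k => u v; apply/eqP; rewrite eq_complex /=; apply/andP; split; apply/eqP; ring.
- move=> a b x; apply: (elt_val_inj gR); first by rewrite /= bmulA.
  by rewrite !(elt_val_pi gR) rep_mul.
- by move=> a b c x y; rewrite !(rz_br gR) !(rz_pi gR) rep_star.
- by move=> a x y; rewrite !(rz_dist gR) !(rz_i gR) -scalerBr rnormZ Re_normC_i mul1r.
- by move=> a; apply: (realization_inj gR); rewrite (rz_i gR) (rz_zero gR) scaler0.
- by move=> a x; apply: (realization_inj gR); rewrite !(rz_i gR, rz_opp gR) scalerN.
- move=> a x y; apply: (realization_inj gR); rewrite !(rz_i gR, rz_mid gR).
  by rewrite -scalerDr !scalerA mulrC.
- by move=> a b x; apply: (realization_inj gR); rewrite !(rz_i gR, rz_pi gR) repZ.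
- move=> a b x y; rewrite !(rz_br gR) !(rz_i gR) linearZl_LR/= linearZr_LR/=.
  by case: (inner _ _) => u v /=; ring.
- move=> a x; apply: (realization_inj gR); rewrite !(rz_i gR, rz_opp gR) scalerA.
  by rewrite -expr2 sqr_i scaleN1r.
- move=> a s; apply: inf_norm_sum_le => e e0.
  set u := \sum_(x <- s) elt_val g x.
  have normE z : norm_sum (rcons [seq elt_pi a x | x <- s] (mkelt (mopp z))) =
      rnorm (p a u - g a z).
    rewrite (norm_sumE gR) big_rcons big_map -(rz_opp gR) /u rep_sum.
    by under eq_bigr do rewrite (elt_val_pi gR).
  rewrite (norm_sumE gR) -/u.
  have [u1|u1] := leP (rnorm u) 1.
    have [z zE] := realization_ball gR a u1; exists z; rewrite normE zE subrr rnorm0.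
    by rewrite addr_ge0 ?(ltW e0)// mulr_ge0// rnorm_ge0.
  (* For (BallImg) outside the ball, [u] is replaced by its radial projection, at distance
     [rnorm u - 1]. *)
  have u0 : 0 < rnorm u := lt_trans ltr01 u1.
  have nE (r : R) : rnorm (r%:C *: u) = `|r| * rnorm u.
    by rewrite rnormZ [complex.Re _]cabs_real.
  have [|z zE] := @realization_ball _ _ _ _ _ _ gR a ((rnorm u)^-1%:C *: u).
    by rewrite nE gtr0_norm ?invr_gt0// mulVf// gt_eqF.
  exists z; rewrite normE zE -repN -repD (le_trans (rep_contractive _ _ _))//.
  rewrite -{1}[u]scale1r -scalerBl -(rmorph1 (real_complex R)) -rmorphB nE.
  rewrite mulrC -[leLHS]addr0 lerD ?(ltW e0)// ler_wpM2r ?rnorm_ge0//.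
  rewrite -[X in _ * X](gtr0_norm u0) -normrM mulrBl mul1r mulVf ?gt_eqF//.
- move=> a b.
  (* All the infima in (DenseImg) vanish, so the supremum is that of the singleton of 0. *)
  suff H (x : M (bmul a b)) :
      inf (range (fun z : M b => norm_sum [:: mkelt (mpi a z); mkelt (mopp x)])) = 0.
    transitivity (sup [set (0 : R)]); last exact: sup1.
    congr sup; apply/seteqP; split=> [_ [x _ <-]|_ ->]; first exact: H.
    by exists (mzero M _).
  apply/eqP; rewrite eq_le; apply/andP; split; last first.
    by apply: inf_norm_sum_ge0; exact: carrier_inhabited.
  apply: inf_norm_sum_le => e /(realization_approx gR x)[y y1 xy].
  have [z zE] := realization_ball gR b y1; exists z.
  rewrite (norm_sumE gR) !big_cons big_nil addr0 add0r !elt_val_mk.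
  by rewrite (rz_pi gR) (rz_opp gR) zE -rep_mul rnorm_sub ltW.
- move=> a b; apply: ge_sup.
    by case: (carrier_inhabited M a) => x; exists (inf (range (fun z : M b =>
      norm_sum [:: mkelt z; mkelt (mopp x)]))), x.
  move=> _ [x _ <-]; apply: inf_norm_sum_le => e /(realization_approx gR x)[y y1 xy].
  (* For (HausDist) the same [y] of the unit ball is used on both sides: [p a y] and [p b y] are at
     distance at most [rnorm (a - b)]. *)
  have [z zE] := realization_ball gR b y1; exists z.
  rewrite (norm_sumE gR) !big_cons big_nil addr0 !elt_val_mk (rz_opp gR) zE.
  rewrite rnorm_sub -[g a x](subrK (p a y)) -addrA -rep_algB addrC.
  rewrite (le_trans (ler_rnormD _ _))// lerD ?(ltW xy)//.
  by rewrite (le_trans (rep_contractive _ _ _))// ler_piMr// rnorm_ge0.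
Qed.

(** * Uniqueness *)

Section TotalFamily.
Variables (R : realType) (J : Type).

Definition total_family (E : hilbertType R) (f : J -> E) :=
  forall F : set E, closed_subspace F -> (forall j, F (f j)) -> forall x, F x.

Definition vcomb (E : hilbertType R) (f : J -> E) (t : seq (R[i] * J)) : E :=
  \sum_(x <- t) x.1 *: f x.2.

Section OneFamily.
Variables (E : hilbertType R) (f : J -> E).

Lemma vcomb_cat s t : vcomb f (s ++ t) = vcomb f s + vcomb f t.
Proof. exact: big_cat. Qed.

Lemma vcomb_scale z s : vcomb f (lscale z s) = z *: vcomb f s.
Proof.
rewrite /vcomb big_map scaler_sumr; apply: eq_bigr => x _ /=.
by rewrite scalerA.
Qed.

(** The limits of combinations form a closed subspace containing the family, so totality makes it
    everything. *)
Lemma total_family_dense x (e : R) : total_family f -> 0 < e ->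
  exists t, rnorm (x - vcomb f t) < e.
Proof.
move=> ft; move: x e.
pose F : set E := [set x | forall e : R, 0 < e -> exists t, rnorm (x - vcomb f t) < e].
suff FE x : F x by move=> x e; exact: FE.
apply: ft; last first.
  move=> j e e0; exists [:: (1, j)].
  by rewrite /vcomb big_seq1 scale1r subrr rnorm0.
split.
- by move=> e e0; exists [::]; rewrite /vcomb big_nil subr0 rnorm0.
- move=> k {}x y Fx Fy e e0.
  have k1 : 0 < cabs k + 1 by rewrite ltr_wpDl ?cabs_ge0.
  have e20 : 0 < e / 2 by rewrite divr_gt0.
  have [s xs] := Fx _ (divr_gt0 e20 k1).
  have [t yt] := Fy _ e20.
  exists (lscale k s ++ t); rewrite vcomb_cat vcomb_scale opprD addrACA -scalerBr.
  rewrite (le_lt_trans (ler_rnormD _ _))// [ltRHS]splitr ltr_leD ?(ltW yt)//.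
  rewrite rnormZ -/(cabs k).
  apply: (@le_lt_trans _ _ ((cabs k + 1) * rnorm (x - vcomb f s))).
    by rewrite ler_wpM2r ?rnorm_ge0// lerDl.
  by rewrite mulrC -ltr_pdivlMr.
- move=> {}x /closure_rnorm Fx e e0; have e20 : 0 < e / 2 by rewrite divr_gt0.
  have [y Fy xy] := Fx _ e20; have [t yt] := Fy _ e20; exists t.
  rewrite -[x](subrK y) -addrA (le_lt_trans (ler_rnormD _ _))//.
  by rewrite [ltRHS]splitr ltrD.
Qed.

End OneFamily.

Section TwoFamilies.
Variables (E E' : hilbertType R) (f : J -> E) (f' : J -> E').
Hypothesis gram : forall i j, inner (f i) (f j) = inner (f' i) (f' j).

Lemma inner_vcomb s t :
  inner (vcomb f s) (vcomb f t) = inner (vcomb f' s) (vcomb f' t).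
Proof.
rewrite /vcomb !linear_sumlz; apply: eq_bigr => x _.
rewrite !linear_sumr; apply: eq_bigr => y _.
by rewrite !linearZl_LR/= !linearZr_LR/= gram.
Qed.

Lemma rnorm_vcomb s : rnorm (vcomb f s) = rnorm (vcomb f' s).
Proof.
apply/eqP; rewrite -(eqrXn2 (ltn0Sn 1)) ?rnorm_ge0//.
by rewrite -!Re_inner_sqr inner_vcomb.
Qed.

(** The graph of the future unitary, pairing limits taken along the same coefficients. As a relation
    it needs no choice of approximating sequence, and its symmetry in the two families provides the
    inverse map. *)
Definition comb_graph (x : E) (y : E') := exists t : nat -> seq (R[i] * J),
  vcomb f (t n) @[n --> \oo] --> x /\ vcomb f' (t n) @[n --> \oo] --> y.

Lemma comb_graph_linear k x x' y y' : comb_graph x y -> comb_graph x' y' ->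
  comb_graph (k *: x + x') (k *: y + y').
Proof.
move=> [s [sx sy]] [t [tx ty]]; exists (fun n => lscale k (s n) ++ t n); split.
  under eq_fun do rewrite vcomb_cat vcomb_scale.
  by apply: cvgD => //; exact: cvgZl_tmp.
under eq_fun do rewrite vcomb_cat vcomb_scale.
by apply: cvgD => //; exact: cvgZl_tmp.
Qed.

Lemma comb_graph_inner x x' y y' : comb_graph x y -> comb_graph x' y' ->
  inner x x' = inner y y'.
Proof.
move=> [s [sx sy]] [t [tx ty]]; rewrite !inner_polar.
apply: (@cvg_unique R[i]^o _ (polar (vcomb f (s n)) (vcomb f (t n)) @[n --> \oo])) => //.
  exact: cvg_polar.
rewrite (_ : (fun n => _) = (fun n => polar (vcomb f' (s n)) (vcomb f' (t n)))).
  exact: cvg_polar.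
by apply/funext => n; rewrite -[LHS]inner_polar -[RHS]inner_polar inner_vcomb.
Qed.

(** By linearity 0 is related to [y - y'], whose norm is then 0 because the relation preserves inner
    products. *)
Lemma comb_graph_fun x y y' : comb_graph x y -> comb_graph x y' -> y = y'.
Proof.
move=> xy xy'; have := comb_graph_linear (-1) xy' xy.
rewrite !scaleN1r !addNr => H0; have := comb_graph_inner H0 H0.
rewrite linear0l => /esym/(congr1 (@complex.Re R)); rewrite Re_inner_sqr.
move=> /eqP; rewrite sqrf_eq0 => /eqP/rnorm_eq0/eqP.
by rewrite addrC subr_eq0 => /eqP.
Qed.

(** Equal Gram matrices give differences of combinations equal norms on both sides, so a convergent
    sequence in [E] has a Cauchy counterpart in [E']. *)
Lemma comb_graph_total x : total_family f -> exists y, comb_graph x y.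
Proof.
move=> ft; have [t tx] : exists t : nat -> seq (R[i] * J), vcomb f (t n) @[n --> \oo] --> x.
  by apply: cvg_dense_rnorm => e; exact: total_family_dense.
suff /cvg_ex[y ty] : cvg (vcomb f' (t n) @[n --> \oo]) by exists y, t.
apply: cauchy_cvg; apply/cauchy_ballP => e e0.
have eE : (complex.Re e)%:C = e by rewrite RRe_real// gtr0_real.
have e20 : 0 < complex.Re e / 2 by rewrite divr_gt0// -ltcR eE.
have Pt := (cvg_rnormP _ _).1 tx _ e20.
set P := [set n | rnorm (x - vcomb f (t n)) < complex.Re e / 2].
have Q : \forall n \near \oo, ((fun n => vcomb f' (t n)) @` P) (vcomb f' (t n)).
  by near=> n; exists n => //; near: n; exact: Pt.
exists ((fun n => vcomb f' (t n)) @` P, (fun n => vcomb f' (t n)) @` P) => //.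
move=> [_ _] /= [[m /= Pm <-] [n /= Pn <-]].
rewrite -ball_normE/= rnormE -eE ltcR.
have -> : vcomb f' (t m) - vcomb f' (t n) = vcomb f' (t m ++ lscale (-1) (t n)).
  by rewrite vcomb_cat vcomb_scale scaleN1r.
rewrite -rnorm_vcomb vcomb_cat vcomb_scale scaleN1r -[vcomb f (t m)](subrK x).
rewrite -addrA (le_lt_trans (ler_rnormD _ _))// [ltRHS]splitr ltrD//.
by rewrite rnorm_sub.
Unshelve. all: by end_near. Qed.

End TwoFamilies.

Lemma comb_graph_sym (E E' : hilbertType R) (f : J -> E) (f' : J -> E') x y :
  comb_graph f f' x y -> comb_graph f' f y x.
Proof. by move=> [t [tx ty]]; exists t. Qed.

End TotalFamily.

(** * Unitary equivalence of two realizations of the same structure *)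

Section Uniqueness.
Variables (R : realType) (A : banachStarAlgType R) (M : lstructure (LA A)).

Lemma total_elt_val (E : hilbertType R) (p : star_rep A E) (g : forall a, M a -> E) :
  nondegenerate_rep p -> realization p g -> total_family (@elt_val _ _ _ _ g).
Proof.
move=> pN gR F Fcl Fg x.
suff : smallest (@closed_subspace R E) [set x | exists a y, x = p a y] x.
  apply; split=> // _ [a [y ->]].
  have [->|y0] := eqVneq y 0; first by rewrite rep0; case: Fcl.
  have n0 : rnorm y != 0 by apply: contra_neq y0; exact: rnorm_eq0.
  have n1 : rnorm ((rnorm y)^-1%:C *: y) <= 1.
    by rewrite rnormZ [complex.Re _]cabs_real ger0_norm ?invr_ge0 ?rnorm_ge0// mulVf.
  have [z zE] := realization_ball gR a n1.
  have -> : p a y = (rnorm y)%:C *: g a z + 0.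
    by rewrite addr0 zE repZ scalerA -rmorphM mulfV// scale1r.
  by case: Fcl => F0 Flin _; apply: Flin => //; exact: (Fg (mkelt z)).
by rewrite pN.
Qed.

(** Brackets only see real parts; the symbol [i] supplies the imaginary ones, so the structure
    determines the complex Gram matrix. *)
Lemma inner_rinner (E : hilbertType R) (x y : E) :
  inner x y = rinner x y +i* rinner x ('i *: y).
Proof.
rewrite /rinner linearZr_LR/=; case: (inner x y) => u v /=.
by congr (_ +i* _); ring.
Qed.

Lemma cvg_rep (E : hilbertType R) (p : star_rep A E) a (u_ : nat -> E) u :
  u_ n @[n --> \oo] --> u -> p a (u_ n) @[n --> \oo] --> p a u.
Proof.
apply: (@cvg_bounded_additive _ _ _ _ (rnorm a)); first exact: rnorm_ge0.
- by move=> x y; rewrite repD repN.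
- exact: rep_contractive.
Qed.

Lemma rep_vcomb (E : hilbertType R) (p : star_rep A E) (g : forall a, M a -> E)
    a (t : seq (R[i] * elt M)) : realization p g ->
  p a (vcomb (@elt_val _ _ _ _ g) t) =
  vcomb (@elt_val _ _ _ _ g) [seq (x.1, elt_pi a x.2) | x <- t].
Proof.
move=> gR; rewrite rep_sum /vcomb big_map; apply: eq_bigr => x _ /=.
by rewrite repZ (elt_val_pi gR).
Qed.

Lemma realization_unitary (E E' : hilbertType R) (p : star_rep A E) (p' : star_rep A E')
    (g : forall a, M a -> E) (g' : forall a, M a -> E') :
  nondegenerate_rep p -> nondegenerate_rep p' ->
  realization p g -> realization p' g' -> unitarily_equivalent p p'.
Proof.
move=> pN pN' gR gR'.
set f := @elt_val _ _ _ _ g; set f' := @elt_val _ _ _ _ g'.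
have gram x y : inner (f x) (f y) = inner (f' x) (f' y).
  rewrite !inner_rinner -(elt_val_i gR) -(elt_val_i gR').
  by rewrite -!(elt_brE gR) -!(elt_brE gR').
have gram' x y : inner (f' x) (f' y) = inner (f x) (f y) by rewrite gram.
have ft := total_elt_val pN gR; have ft' := total_elt_val pN' gR'.
have /choice[U UP] x := comb_graph_total gram x ft.
have /choice[V VP] y := comb_graph_total gram' y ft'.
have UE x y : comb_graph f f' x y -> U x = y by exact: comb_graph_fun.
exists U; split.
- by move=> k x y; apply: UE; exact: comb_graph_linear.
- exists V => [x|y]; last by apply: UE; exact: comb_graph_sym.
  by apply: (comb_graph_fun gram' (VP _)); exact: comb_graph_sym.
- by move=> x y; rewrite (comb_graph_inner gram (UP x) (UP y)).
(* Both representations act on combinations by the same substitution [elt_pi a], so the image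
   sequences again share their coefficients. *)
- move=> a x; apply: UE; have [t [tx ty]] := UP x.
  exists (fun n => [seq (x.1, elt_pi a x.2) | x <- t n]); split.
    by under eq_fun do rewrite -(rep_vcomb _ _ gR); exact: cvg_rep.
  by under eq_fun do rewrite -(rep_vcomb _ _ gR'); exact: cvg_rep.
Qed.

End Uniqueness.

(** * The representation of a model *)

Section Premodel.
Variables (R : realType) (A : banachStarAlgType R) (M : lstructure (LA A)).

(* The consequences of T^A from which the representation is built.  The scheme
   (Conv) only enters through [pm_dist] and [pm_mid_opp], which continuous logic
   can express. *)
Record premodel : Prop := Premodel {
  pm_dist : forall (a : A) (x y : M a),
    mdist x y = 2 * mdist (mmid x (mopp y)) (mzero M a);
  pm_mid_opp : forall (a : A) (x : M a), mmid x (mopp x) = mzero M a;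
  pm_radius : forall (a : A) (x : M a), mdist x (mzero M a) <= rnorm a;
  pm_sym : forall x y : elt M, elt_br x y = elt_br y x;
  pm_mid : forall (a : A) (x : elt M) (y y' : M a),
    elt_br x (mkelt (mmid y y')) = (elt_br x (mkelt y) + elt_br x (mkelt y')) / 2;
  pm_zero : forall (a : A) (x : elt M), elt_br x (mkelt (mzero M a)) = 0;
  pm_norm : forall (a : A) (x : M a),
    elt_br (mkelt x) (mkelt x) = mdist x (mzero M a) ^+ 2;
  pm_pos : forall s : seq (elt M), 0 <= br_sum s;
  pm_pi : forall a (s : seq (elt M)),
    norm_sum [seq elt_pi a x | x <- s] <= rnorm a * norm_sum s;
  pm_pi_add : forall a b (x : elt M),
    norm_sum [:: elt_pi (a + b) x; elt_opp (elt_pi a x); elt_opp (elt_pi b x)] = 0;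
  pm_pi_scale : forall (k : R[i]) a (x : elt M),
    norm_comb [:: (1, elt_pi (k *: a) x); (- complex.Re k, elt_pi a x);
                  (- complex.Im k, elt_i (elt_pi a x))] = 0;
  pm_pi_mul : forall a b (x : elt M),
    elt_pi (bmul a b) x = elt_pi a (elt_pi b x);
  pm_pi_star : forall a (x y : elt M),
    elt_br (elt_pi a x) y = elt_br x (elt_pi (bstar a) y);
  pm_i_br : forall x y : elt M, elt_br (elt_i x) (elt_i y) = elt_br x y;
  pm_i_sqr : forall x : elt M, elt_i (elt_i x) = elt_opp x;
  pm_i_pi : forall a (x : elt M), elt_i (elt_pi a x) = elt_pi a (elt_i x);
  pm_ball : forall a (s : seq (elt M)),
    inf (range (fun z : M a =>
      norm_sum (rcons [seq elt_pi a x | x <- s] (mkelt (mopp z)))))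
    <= `|norm_sum s - 1| * rnorm a;
  pm_dense : forall a b,
    sup (range (fun x : M (bmul a b) => inf (range (fun z : M b =>
      norm_sum [:: mkelt (mpi a z); mkelt (mopp x)])))) = 0;
  pm_haus : forall a b : A,
    sup (range (fun x : M a => inf (range (fun z : M b =>
      norm_sum [:: mkelt z; mkelt (mopp x)])))) <= rnorm (a - b)
}.

Lemma model_premodel : model_TA M -> premodel.
Proof.
case=> hC hr hs h1 h2 hn hp hpi hadd hsc hmul hst _ _ _ _ hipi hibr hisq hb hd hh.
split=> //.
- move=> a x y; have [V [e [ed _ e0 eN em]]] := hC a.
  rewrite !ed em e0 eN subr0 normrZ ger0_norm ?invr_ge0//.
  by rewrite mulrA divff// mul1r.
- move=> a x; have [V [e [ed _ e0 eN em]]] := hC a.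
  by apply: mdist_positivity; rewrite ed em eN subrr scaler0 e0 subrr normr0.
- by move=> [a x] [b y]; exact: hs.
- by move=> a [b x] y y'; exact: h1.
- by move=> a [b x]; exact: h2.
- by move=> a [b x] [c y]; exact: hst.
- by move=> [a x] [b y]; exact: hibr.
- by move=> [a x]; congr existT; exact: hisq.
- by move=> a [b x]; congr existT; exact: hipi.
Qed.

Hypothesis MP : premodel.
Implicit Types (x y z : elt M) (s : seq (elt M)) (t : seq (R[i] * elt M)).

(** The midpoint of [y] and its opposite is 0, where the bracket vanishes. *)
Lemma br_opp x y : elt_br x (elt_opp y) = - elt_br x y.
Proof.
case: y => a y; have := pm_mid MP x y (mopp y).
rewrite (pm_mid_opp MP) (pm_zero MP); rewrite /elt_opp /=.
rewrite -/(mkelt y); lra.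
Qed.

Lemma br_i_sqr x y : elt_br x (elt_i (elt_i y)) = - elt_br x y.
Proof. by rewrite (pm_i_sqr MP) br_opp. Qed.

Lemma br_ir x y : elt_br x (elt_i y) = - elt_br (elt_i x) y.
Proof. by rewrite -(pm_i_br MP) br_i_sqr. Qed.

(** By [pm_dist] the distance is twice the norm of half the difference, and that norm comes from the
    bracket: the metric of a sort is the one of the form. *)
Lemma mdist_sqr (a : A) (x y : M a) : mdist x y ^+ 2 =
  elt_br (mkelt x) (mkelt x) - 2 * elt_br (mkelt x) (mkelt y) + elt_br (mkelt y) (mkelt y).
Proof.
set m := mmid x (mopp y).
have mE z : elt_br (mkelt m) z = (elt_br (mkelt x) z - elt_br (mkelt y) z) / 2.
  rewrite (pm_sym MP) (pm_mid MP) (pm_sym MP z (mkelt x)) (pm_sym MP (mkelt y) z).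
  by rewrite -br_opp.
rewrite (pm_dist MP) -/m exprMn -(pm_norm MP) mE.
rewrite (pm_sym MP (mkelt x) (mkelt m)) (pm_sym MP (mkelt y) (mkelt m)) !mE.
by rewrite (pm_sym MP (mkelt y) (mkelt x)); field.
Qed.

Lemma br_lipschitz (a : A) (x y : M a) z :
  `|elt_br (mkelt x) z - elt_br (mkelt y) z| <= (rnorm a + rnorm (projT1 z)) * mdist x y.
Proof.
have := @pred_interp_unif _ _ M (a, projT1 z) (mdist x y) (mdist_ge0 _ _) x y (lexx _)
  (projT2 z) (projT2 z).
by rewrite /within_dist mdistxx => /(_ (mdist_ge0 _ _)).
Qed.

(** Sorts have no scalar multiplication; brackets against all elements say that [y] is [r] times
    [x]. *)
Definition is_multiple (a : A) (x : M a) (r : R) :=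
  exists y : M a, forall z, elt_br (mkelt y) z = r * elt_br (mkelt x) z.

(** Binary expansion of [r]: a midpoint with 0 or with [x] prepends the digit 0 or 1 and halves the
    error. *)
Lemma is_multiple_approx (a : A) (x : M a) n r : 0 <= r -> r <= 1 ->
  exists2 q, is_multiple x q & `|r - q| <= 2^-1 ^+ n.
Proof.
elim: n r => [|n IH] r r0 r1.
  exists 0; last by rewrite subr0 ger0_norm.
  by exists (mzero M a) => z; rewrite (pm_sym MP) (pm_zero MP) mul0r.
have [r2|r2] := leP r (2^-1).
  have [||q [y yE] rq] := IH (2 * r); [lra|lra|].
  exists (2^-1 * q).
    exists (mmid y (mzero M a)) => z.
    by rewrite (pm_sym MP) (pm_mid MP) (pm_zero MP) (pm_sym MP) yE; field.
  have -> : r - 2^-1 * q = 2^-1 * (2 * r - q) by field.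
  by rewrite normrM ger0_norm ?invr_ge0// exprS ler_wpM2l ?invr_ge0.
have [||q [y yE] rq] := IH (2 * r - 1); [lra|lra|].
exists (2^-1 * (q + 1)).
  exists (mmid y x) => z.
  by rewrite (pm_sym MP) (pm_mid MP) ![elt_br z _](pm_sym MP) yE; field.
have -> : r - 2^-1 * (q + 1) = 2^-1 * (2 * r - 1 - q) by field.
by rewrite normrM ger0_norm ?invr_ge0// exprS ler_wpM2l ?invr_ge0.
Qed.

Lemma is_multiple_dist (a : A) (x y y' : M a) q q' :
  (forall z, elt_br (mkelt y) z = q * elt_br (mkelt x) z) ->
  (forall z, elt_br (mkelt y') z = q' * elt_br (mkelt x) z) ->
  mdist y y' = `|q - q'| * mdist x (mzero M a).
Proof.
move=> yE yE'; apply/eqP.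
rewrite -(eqrXn2 (ltn0Sn 1)) ?mulr_ge0 ?mdist_ge0//; apply/eqP.
rewrite mdist_sqr exprMn real_normK ?num_real// -(pm_norm MP).
rewrite !yE yE' ![elt_br (mkelt x) _](pm_sym MP) yE yE'; ring.
Qed.

(** By [is_multiple_dist] the dyadic approximations are Cauchy in the complete sort; brackets pass
    to their limit by [br_lipschitz]. *)
Lemma is_multiple01 (a : A) (x : M a) r : 0 <= r -> r <= 1 -> is_multiple x r.
Proof.
move=> r0 r1.
have /choice[q qP] n : exists q, exists y : M a,
    (forall z, elt_br (mkelt y) z = q * elt_br (mkelt x) z) /\ `|r - q| <= 2^-1 ^+ n.
  by have [q [y yE] rq] := is_multiple_approx x n r0 r1; exists q, y.
have /choice[y yP] := qP.
have qr e : 0 < e -> \forall n \near \oo, `|r - q n| < e.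
  move=> e0.
  have h1 : `|2^-1 : R| < 1 by rewrite ger0_norm ?invr_ge0// invf_lt1// ltr1n.
  have /cvgrPdist_lt/(_ e e0) h2 := cvg_expr h1.
  near=> n; have [_ /le_lt_trans] := yP n; apply.
  suff : `|0 - 2^-1 ^+ n| < e by rewrite sub0r normrN ger0_norm// exprn_ge0 ?invr_ge0.
  by near: n.
pose d := mdist x (mzero M a); have d1 : 0 < d + 1 by rewrite ltr_wpDl ?mdist_ge0.
have [l yl] : exists l : M a, y n @[n --> \oo] --> l.
  apply: carrier_complete; apply/cauchy_ballP => e e0.
  have e2 : 0 < e / 2 / (d + 1) by rewrite !divr_gt0.
  set P := [set n | `|r - q n| < e / 2 / (d + 1)].
  have Q : \forall n \near \oo, (y @` P) (y n).
    by near=> n; exists n => //; near: n; exact: qr.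
  exists (y @` P, y @` P) => // -[_ _] /= [[m Pm <-] [n Pn <-]].
  rewrite ballEmdist/= (is_multiple_dist (yP m).1 (yP n).1) -/d.
  apply: (@le_lt_trans _ _ (`|q m - q n| * (d + 1))).
    by rewrite ler_wpM2l// lerDl.
  rewrite -ltr_pdivlMr// -[q m](subrK r) -addrA (le_lt_trans (ler_normD _ _))//.
  rewrite [e]splitr mulrDl ltrD//.
  by rewrite distrC.
exists l => z; apply/eqP; rewrite -subr_eq0 -normr_le0; apply/ler_addgt0Pr => e e0.
rewrite add0r; have e2 : 0 < e / 2 by rewrite divr_gt0.
have c1 : 0 < rnorm a + rnorm (projT1 z) + 1 by rewrite ltr_wpDl// addr_ge0// rnorm_ge0.
have b1 : 0 < `|elt_br (mkelt x) z| + 1 by rewrite ltr_wpDl.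
near \oo => n.
have ln : mdist l (y n) < e / 2 / (rnorm a + rnorm (projT1 z) + 1).
  near: n; apply: metricType_numDomainType.cvgr_dist_lt => //; exact: divr_gt0.
have rn : `|r - q n| < e / 2 / (`|elt_br (mkelt x) z| + 1).
  by near: n; apply: qr; exact: divr_gt0.
rewrite -(subrK (elt_br (mkelt (y n)) z) (elt_br (mkelt l) z)) -addrA.
rewrite (le_trans (ler_normD _ _))// [e]splitr lerD//.
  rewrite (le_trans (br_lipschitz _ _ _))// mulrC.
  move: ln; rewrite ltr_pdivlMr// => /ltW; apply: le_trans.
  by rewrite ler_wpM2l ?mdist_ge0// lerDl.
rewrite (yP n).1 -mulrBl normrM distrC.
move: rn; rewrite ltr_pdivlMr// => /ltW; apply: le_trans.
by rewrite ler_wpM2l// lerDl.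
Unshelve. all: by end_near. Qed.

(** Sorts are bounded, so [c] times [x] need not be one element: it is the sum of [n] copies of [x]
    scaled by [|c| / n], which is at most 1, or of their opposites. *)
Lemma real_multiple (c : R) x : exists s, forall z,
  \sum_(y <- s) elt_br y z = c * elt_br x z.
Proof.
case: x => a x; pose n := (Num.trunc `|c|).+1.
have cn : `|c| <= n%:R by rewrite ltW// truncnS_gt.
have n0 : 0 < n%:R :> R by rewrite ltr0n.
have [||y yE] := @is_multiple01 a x (`|c| / n%:R).
- by rewrite divr_ge0.
- by rewrite ler_pdivrMr// mul1r.
have sumE (w : elt M) z : \sum_(y <- nseq n w) elt_br y z = n%:R * elt_br w z.
  by rewrite big_nseq iter_addr_0 mulr_natl.
have [c0|c0] := leP 0 c.
  exists (nseq n (mkelt y)) => z; rewrite sumE yE ger0_norm//.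
  by rewrite mulrA mulrCA divff ?mulr1// gt_eqF.
exists (nseq n (elt_opp (mkelt y))) => z; rewrite sumE (pm_sym MP) br_opp (pm_sym MP) yE.
rewrite ltr0_norm// -[existT _ _ _]/(mkelt x).
by field; rewrite gt_eqF.
Qed.

Definition br_kernel x y : R[i] := elt_br x y +i* elt_br x (elt_i y).

Lemma br_kernelC x y : br_kernel y x = (br_kernel x y)^*.
Proof.
rewrite /br_kernel (pm_sym MP y x) br_ir (pm_sym MP _ x).
by apply/eqP; rewrite eq_complex /= !eqxx.
Qed.

(* The axioms of T^A only bound the norms of real combinations of elements of M;
   they reach the complex combination t through a real one, r. *)
Definition represents (r : seq (R * elt M)) t := forall z,
  \sum_(y <- r) y.1 * elt_br y.2 z = complex.Re (lcomb br_kernel t z).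

Lemma Re_sum (J : Type) (s : seq J) (F : J -> R[i]) :
  complex.Re (\sum_(j <- s) F j) = \sum_(j <- s) complex.Re (F j).
Proof. by elim/big_rec2: _ => // j u v _ <-; rewrite ReD. Qed.

Lemma Im_sum (J : Type) (s : seq J) (F : J -> R[i]) :
  complex.Im (\sum_(j <- s) F j) = \sum_(j <- s) complex.Im (F j).
Proof. by elim/big_rec2: _ => // j u v _ <-; case: (F j) v => ? ? []. Qed.

Lemma Re_lcomb t z : complex.Re (lcomb br_kernel t z) =
  \sum_(x <- t) (complex.Re x.1 * elt_br x.2 z + complex.Im x.1 * elt_br (elt_i x.2) z).
Proof.
rewrite /lcomb Re_sum; apply: eq_bigr => -[[u v] x] _ /=.
by rewrite br_ir mulrN opprK.
Qed.

(** All coefficients are 1, as (Pos), (Pi1) and (BallImg) require: the complex coefficients are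
    absorbed into the elements. *)
Lemma exists_represents t : exists s, represents [seq (1, y) | y <- s] t.
Proof.
elim: t => [|[c x] t [s sE]].
  by exists [::] => z; rewrite Re_lcomb !big_nil.
have [s1 s1E] := real_multiple (complex.Re c) x.
have [s2 s2E] := real_multiple (complex.Im c) (elt_i x).
exists (s1 ++ s2 ++ s) => z; rewrite Re_lcomb big_cons -Re_lcomb -sE.
rewrite !map_cat !big_cat/= !big_map addrA; congr (_ + _).
by rewrite -s1E -s2E; congr (_ + _); apply: eq_bigr => y _; rewrite mul1r.
Qed.

(** Real parts at all elements thus determine a combination, and real identities suffice. *)
Lemma Im_lcomb t z :
  complex.Im (lcomb br_kernel t z) = complex.Re (lcomb br_kernel t (elt_i z)).
Proof.
rewrite /lcomb; elim/big_rec2: _ => // -[[c d] x] p q _ qE; rewrite /br_kernel /=.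
case: p q qE => [p1 p2] [q1 q2] /= ->; rewrite br_i_sqr; ring.
Qed.

Lemma Re_lpair r t t' : represents r t ->
  complex.Re (lpair (lcomb br_kernel t) t') =
  \sum_(y <- r) y.1 * complex.Re (lcomb br_kernel t' y.2).
Proof.
move=> rt; under [RHS]eq_bigr do rewrite Re_lcomb mulr_sumr.
rewrite exchange_big/= /lpair Re_sum; apply: eq_bigr => -[[u v] z] _ /=.
transitivity (u * complex.Re (lcomb br_kernel t z) + v * complex.Im (lcomb br_kernel t z)).
  by case: (lcomb _ _ _) => p q /=; ring.
rewrite Im_lcomb -!rt !mulr_sumr -big_split; apply: eq_bigr => -[c y] _ /=.
by rewrite (pm_sym MP z y) (pm_sym MP (elt_i z)); ring.
Qed.

Lemma Re_kform_represents r t : represents r t ->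
  complex.Re (lpair (lcomb br_kernel t) t) =
  \sum_(x <- r) \sum_(y <- r) x.1 * y.1 * elt_br x.2 y.2.
Proof.
move=> rt; rewrite (Re_lpair _ rt); apply: eq_bigr => x _.
rewrite -rt mulr_sumr; apply: eq_bigr => y _.
by rewrite (pm_sym MP y.2) mulrA.
Qed.

Lemma norm_comb1 s : norm_comb [seq (1, y) | y <- s] = norm_sum s.
Proof.
rewrite /norm_comb /norm_sum /br_sum big_map; congr Num.sqrt; apply: eq_bigr => x _.
by rewrite big_map; apply: eq_bigr => y _; rewrite !mul1r.
Qed.

Lemma br_kernel_ge0 t : 0 <= complex.Re (lpair (lcomb br_kernel t) t).
Proof.
have [s st] := exists_represents t; rewrite (Re_kform_represents st).
have := pm_pos MP s; rewrite /br_sum; congr (_ <= _).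
rewrite big_map; apply: eq_bigr => x _.
by rewrite big_map; apply: eq_bigr => y _; rewrite !mul1r.
Qed.

Definition model_kernel := PdKernel br_kernelC br_kernel_ge0.

Lemma knorm_represents r t : represents r t -> knorm model_kernel t = norm_comb r.
Proof. by move=> rt; rewrite /knorm /kform (Re_kform_represents rt). Qed.

End Premodel.

(** * The star-representation on the kernel space *)

Section ModelRep.
Variables (R : realType) (A : banachStarAlgType R) (M : lstructure (LA A)).
Hypothesis MP : premodel M.
Implicit Types (a b : A) (x y z : elt M) (s : seq (elt M)) (t : seq (R[i] * elt M)).

Local Notation K := (model_kernel MP).

Lemma rnorm_star (a : A) : rnorm (bstar a) = rnorm a.
Proof. by rewrite /rnorm bnorm_star. Qed.

Definition pi_comb a t := [seq (u.1, elt_pi a u.2) | u <- t].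

Lemma kernel_pi a x y : K (elt_pi a x) y = K x (elt_pi (bstar a) y).
Proof. by rewrite /= /br_kernel !(pm_pi_star MP) (pm_i_pi MP). Qed.

Lemma lcomb_pi a t : lcomb K (pi_comb a t) = lcomb K t \o elt_pi (bstar a).
Proof.
apply/funext => y; rewrite /lcomb big_map; apply: eq_bigr => x _ /=.
by congr (_ * _); exact: kernel_pi.
Qed.

Lemma lpair_pi f a t : lpair (f \o elt_pi a) t = lpair f (pi_comb a t).
Proof. by rewrite /lpair big_map. Qed.

(** (Pi1) is about plain sums; it applies to a plain sum representing [t], whose image represents
    [pi_comb a t]. *)
Lemma knorm_pi a t : knorm K (pi_comb a t) <= rnorm a * knorm K t.
Proof.
have [s st] := exists_represents MP t.
rewrite (knorm_represents MP st) norm_comb1.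
suff /(knorm_represents MP) -> : represents [seq (1, y) | y <- map (elt_pi a) s] (pi_comb a t).
  by rewrite norm_comb1; exact: pm_pi.
move=> z; transitivity (complex.Re (lcomb (@br_kernel _ _ M) t (elt_pi (bstar a) z))).
  by rewrite -st !big_map; apply: eq_bigr => y _ /=; rewrite (pm_pi_star MP).
by rewrite [lcomb _ (pi_comb a t)](lcomb_pi a t).
Qed.

Lemma kbound_pi f c a : 0 <= c -> kbound K f c -> kbound K (f \o elt_pi a) (rnorm a * c).
Proof.
move=> c0 fc t; rewrite lpair_pi (le_trans (fc _))// mulrC mulrAC ler_wpM2r//.
exact: knorm_pi.
Qed.

(** The formula is forced: the value at [y] is the inner product with the kernel vector of [y],
    across which [a] moves as [bstar a]. *)
Definition rep_pi_fun (a : A) (f : elt M -> R[i]) := f \o elt_pi (bstar a).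

Lemma rep_pi_mem a (f : rkhs K) : rkhs_mem K (rep_pi_fun a f).
Proof.
move=> e e0; have a1 : 0 < rnorm a + 1 by rewrite ltr_wpDl ?rnorm_ge0.
have e1 := divr_gt0 e0 a1.
have [s sP] := rkhs_memP f e1; exists (pi_comb a s).
rewrite lcomb_pi; apply: (@kbound_le _ _ _ _ (rnorm (bstar a) * (e / (rnorm a + 1)))).
  by rewrite rnorm_star mulrA ler_pdivrMr// mulrC ler_wpM2l ?(ltW e0)// lerDl.
exact: kbound_pi (ltW e1) sP.
Qed.

Definition rep_pi a (f : rkhs K) : rkhs K := Rkhs (introT (asboolP _) (@rep_pi_mem a f)).

Lemma rep_pi_linear a : linear (rep_pi a).
Proof. by move=> k f g; apply/val_inj/funext. Qed.

Lemma rkhs_null (f : rkhs K) t : knorm K t = 0 -> lpair f t = 0.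
Proof.
move=> t0; apply: cabs_eq0; apply/eqP; rewrite eq_le cabs_ge0 andbT.
by have := rkhs_bound f t; rewrite t0 mulr0.
Qed.

(** (Pi2) says that a certain combination is null, and every function of the space vanishes on null
    combinations. *)
Lemma rkhs_pi_add (f : rkhs K) a b x :
  f (elt_pi (a + b) x) = f (elt_pi a x) + f (elt_pi b x).
Proof.
pose t := [:: (1, elt_pi (a + b) x); (-1, elt_pi a x); (-1, elt_pi b x)] : seq (R[i] * elt M).
have : lpair f t = 0.
  apply: rkhs_null; rewrite -[RHS](pm_pi_add MP a b x) -norm_comb1.
  apply: knorm_represents => z; rewrite Re_lcomb // !big_cons !big_nil/=.
  by rewrite ![elt_br (elt_opp _) z](pm_sym MP) !br_opp// ![elt_br z _](pm_sym MP); ring.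
rewrite /lpair !big_cons big_nil addr0.
have conjN w : (- w)^* = - w^* :> R[i] by exact: rmorphN.
rewrite /= !conjN (_ : 1^* = 1); last exact: rmorph1.
by rewrite !mulN1r mul1r -opprD => /eqP; rewrite subr_eq0 => /eqP.
Qed.

(** The conjugate appears because functions of the space are antilinear in their index; it cancels
    against [bstarZ] in [rep_pi_linear_alg]. *)
Lemma rkhs_pi_scale (f : rkhs K) k a x :
  f (elt_pi (k *: a) x) = k^* * f (elt_pi a x).
Proof.
pose t := [:: (1, elt_pi (k *: a) x); (- k, elt_pi a x)] : seq (R[i] * elt M).
have : lpair f t = 0.
  apply: rkhs_null; rewrite -[RHS](pm_pi_scale MP k a x).
  apply: knorm_represents => z; rewrite Re_lcomb // !big_cons !big_nil/=.
  by case: (k) => u v /=; ring.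
rewrite /lpair !big_cons big_nil addr0.
have conjN w : (- w)^* = - w^* :> R[i] by exact: rmorphN.
rewrite /= !conjN (_ : 1^* = 1); last exact: rmorph1.
by rewrite mul1r mulNr => /eqP; rewrite subr_eq0 => /eqP.
Qed.

Lemma rep_pi_linear_alg f : linear (fun a => rep_pi a f).
Proof.
move=> k a b; apply/val_inj/funext => y; rewrite /= /rep_pi_fun/=.
by rewrite bstarD bstarZ rkhs_pi_add rkhs_pi_scale conjCK.
Qed.

Lemma rep_pi_contractive a f : rnorm (rep_pi a f) <= rnorm a * rnorm f.
Proof.
apply: rkhs_rnorm_le; first by rewrite mulr_ge0 ?rnorm_ge0.
by rewrite -rnorm_star; apply: kbound_pi; [exact: rnorm_ge0|exact: rkhs_bound].
Qed.

Lemma rep_pi_bounded : exists C : R,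
  forall a f, rnorm (rep_pi a f) <= C * rnorm a * rnorm f.
Proof. by exists 1 => a f; rewrite mul1r rep_pi_contractive. Qed.

Lemma rep_pi_mul a b f : rep_pi (bmul a b) f = rep_pi a (rep_pi b f).
Proof.
apply/val_inj/funext => y; rewrite /= /rep_pi_fun/=.
by rewrite bstarM (pm_pi_mul MP).
Qed.

Lemma rep_pi_lcomb a t : rep_pi a (rkhs_lcomb K t) = rkhs_lcomb K (pi_comb a t).
Proof. by apply: val_inj; rewrite /= lcomb_pi. Qed.

Lemma rep_pi_cvg a (f_ : nat -> rkhs K) f :
  f_ n @[n --> \oo] --> f -> rep_pi a (f_ n) @[n --> \oo] --> rep_pi a f.
Proof.
apply: (@cvg_bounded_additive _ _ _ _ (rnorm a)); first exact: rnorm_ge0.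
- by move=> g h; apply: val_inj.
- exact: rep_pi_contractive.
Qed.

Lemma rep_pi_star a f g : inner (rep_pi a f) g = inner f (rep_pi (bstar a) g).
Proof.
have [s sf] := rkhs_lcomb_cvg f; have [t tg] := rkhs_lcomb_cvg g.
rewrite !inner_polar.
apply: (@cvg_unique R[i]^o _ (polar (rep_pi a (rkhs_lcomb K (s n)))
    (rkhs_lcomb K (t n)) @[n --> \oo])) => //.
  by apply: cvg_polar => //; exact: rep_pi_cvg.
rewrite (_ : (fun n => _) = (fun n => polar (rkhs_lcomb K (s n))
    (rep_pi (bstar a) (rkhs_lcomb K (t n))))).
  by apply: cvg_polar => //; exact: rep_pi_cvg.
apply/funext => n; rewrite !rep_pi_lcomb !polar_lcomb /kform lcomb_pi.
exact: lpair_pi.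
Qed.

Definition model_rep : star_rep A (rkhs K) :=
  StarRep rep_pi_linear rep_pi_linear_alg rep_pi_bounded rep_pi_mul rep_pi_star.

End ModelRep.

Lemma inf_norm_sum_lt (R : realType) (A : banachStarAlgType R) (M : lstructure (LA A))
    (J : Type) (F : J -> seq (elt M)) (c : R) : inhabited J ->
  inf (range (fun z => norm_sum (F z))) < c -> exists z, norm_sum (F z) < c.
Proof.
move=> [j]; rewrite -subr_gt0 => c0.
have hinf : has_inf (range (fun z => norm_sum (F z))).
  by split; [exists (norm_sum (F j)), j|exists 0 => _ [z _ <-]; exact: sqrtr_ge0].
have [_ [z _ <-] zc] := inf_adherent c0 hinf.
by exists z; move: zc; rewrite addrC subrK.
Qed.

(** The common bound [c] keeps the set of infima bounded above; otherwise [sup] could be a default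
    value. *)
Lemma inf_le_sup (R : realType) (A : banachStarAlgType R) (M : lstructure (LA A))
    (J J' : Type) (F : J -> J' -> seq (elt M)) (c : R) (x : J) :
  (forall x, exists z, norm_sum (F x z) <= c) ->
  inf (range (fun z => norm_sum (F x z))) <=
  sup (range (fun x => inf (range (fun z => norm_sum (F x z))))).
Proof.
move=> Fc; apply: ub_le_sup; last by exists x.
exists c => _ [y _ <-]; have [z zc] := Fc y; apply: le_trans zc.
by apply: ge_inf; [exists 0 => _ [w _ <-]; exact: sqrtr_ge0|exists z].
Qed.

(** * The sorts inside the kernel space *)

Section ModelRealization.
Variables (R : realType) (A : banachStarAlgType R) (M : lstructure (LA A)).
Hypothesis MP : premodel M.
Hypothesis A_ball : forall a : A, in_closure_mul_ball a.
Implicit Types (a b : A) (x y z : elt M) (s : seq (elt M)) (t : seq (R[i] * elt M)).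

Local Notation K := (model_kernel MP).
Local Notation p := (model_rep MP).

Definition embed x : rkhs K := rkhs_lcomb K [:: (1, x)].

Lemma embedE x y : embed x y = K x y.
Proof. by rewrite /= /lcomb big_seq1 mul1r. Qed.

Lemma rinner_embed x y : elt_br x y = rinner (embed x) (embed y).
Proof. by rewrite /rinner inner_rkhs_lcomb /kform lpair1 [lcomb _ _ _]embedE. Qed.

Lemma embed_eq (f : rkhs K) x :
  (forall z, elt_br x z = complex.Re (f z) /\ elt_br x (elt_i z) = complex.Im (f z)) ->
  embed x = f.
Proof.
move=> xf; apply/val_inj/funext => z; rewrite [LHS]embedE /= /br_kernel.
by have [-> ->] := xf z; case: (f z).
Qed.

Lemma embed_multiple (r : R) x y :
  (forall z, elt_br x z = r * elt_br y z) -> embed x = r%:C *: embed y.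
Proof.
move=> xy; apply: embed_eq => z.
have -> : (r%:C *: embed y) z = r%:C * K y z by rewrite -embedE.
by rewrite !xy /=; split; ring.
Qed.

Lemma embed_opp x : embed (elt_opp x) = - embed x.
Proof.
rewrite -scaleN1r -(rmorphN1 (real_complex R)); apply: embed_multiple => z.
by rewrite (pm_sym MP) br_opp// mulN1r (pm_sym MP).
Qed.

Lemma embed_zero a : embed (mkelt (mzero M a)) = 0.
Proof.
rewrite -(scale0r (embed (mkelt (mzero M a)))); apply: (@embed_multiple 0) => z.
by rewrite (pm_sym MP) (pm_zero MP) mul0r.
Qed.

Lemma embed_mid a (x y : M a) :
  embed (mkelt (mmid x y)) = 2^-1 *: (embed (mkelt x) + embed (mkelt y)).
Proof.
have -> : (2^-1 : R[i]) = (2^-1)%:C by rewrite fmorphV rmorph_nat.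
apply: embed_eq => z.
have -> : ((2^-1)%:C *: (embed (mkelt x) + embed (mkelt y))) z =
    (2^-1)%:C * (K (mkelt x) z + K (mkelt y) z) by rewrite -!embedE.
have mE w : elt_br (mkelt (mmid x y)) w = (elt_br (mkelt x) w + elt_br (mkelt y) w) / 2.
  by rewrite (pm_sym MP) (pm_mid MP) (pm_sym MP w (mkelt x)) (pm_sym MP w (mkelt y)).
by rewrite !mE /=; split; field.
Qed.

Lemma embed_i x : embed (elt_i x) = 'i *: embed x.
Proof.
apply: embed_eq => z.
have -> : ('i *: embed x) z = 'i * K x z by rewrite -embedE.
by rewrite (pm_i_br MP) /= (br_ir MP); split; ring.
Qed.

Lemma embed_pi a x : embed (elt_pi a x) = p a (embed x).
Proof. by rewrite /= rep_pi_lcomb. Qed.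

Lemma embed_dist a (x y : M a) : mdist x y = rnorm (embed (mkelt x) - embed (mkelt y)).
Proof.
apply/eqP; rewrite -(eqrXn2 (ltn0Sn 1)) ?mdist_ge0 ?rnorm_ge0//; apply/eqP.
rewrite (mdist_sqr MP) -Re_inner_sqr -/(rinner _ _) -embed_opp rinnerDl !rinnerDr.
rewrite -!rinner_embed !(br_opp MP) (pm_sym MP (elt_opp _)) (br_opp MP).
by rewrite (pm_sym MP (elt_opp _) (mkelt y)) (br_opp MP); ring.
Qed.

Lemma embed_norm_sum s : norm_sum s = rnorm (\sum_(x <- s) embed x).
Proof. exact: norm_sum_rinner rinner_embed s. Qed.

(** Plain sums suffice for density, and they are the only vectors whose norm (BallImg) mentions. *)
Lemma embed_sum_dense (f : rkhs K) e : 0 < e ->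
  exists s, rnorm (f - \sum_(x <- s) embed x) < e.
Proof.
move=> e0; have [t ft] := rkhs_lcomb_dense f e0.
have [s st] := exists_represents MP t; exists s.
suff -> : \sum_(x <- s) embed x = rkhs_lcomb K t by [].
apply/val_inj/funext => z.
have sumE : rkhs_fun (\sum_(x <- s) embed x) z = \sum_(x <- s) K x z.
  by elim/big_rec2: _ => // x u f' _ <-; rewrite -embedE.
rewrite [LHS]sumE.
have stE w : \sum_(x <- s) elt_br x w = complex.Re (lcomb (@br_kernel _ _ M) t w).
  by rewrite -st big_map; apply: eq_bigr => x _; rewrite mul1r.
apply/eqP; rewrite eq_complex; apply/andP; split; apply/eqP.
  by rewrite Re_sum -stE.
by rewrite Im_sum Im_lcomb// -stE.
Qed.

Lemma embed_closed a (f : rkhs K) :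
  (forall e, 0 < e -> exists x : M a, rnorm (f - embed (mkelt x)) < e) ->
  exists x : M a, embed (mkelt x) = f.
Proof.
move=> /(cvg_dense_rnorm (u := fun x : M a => embed (mkelt x)))[x_ xf].
have xP e : 0 < e -> \forall n \near \oo, rnorm (f - embed (mkelt (x_ n))) < e.
  exact: (cvg_rnormP _ _).1 xf e.
have [l xl] : exists l : M a, x_ n @[n --> \oo] --> l.
  apply: carrier_complete; apply/cauchy_ballP => e e0.
  have e20 : 0 < e / 2 by rewrite divr_gt0.
  set P := [set n | rnorm (f - embed (mkelt (x_ n))) < e / 2].
  have Q : \forall n \near \oo, (x_ @` P) (x_ n).
    by near=> n; exists n => //; near: n; exact: xP.
  exists (x_ @` P, x_ @` P) => // -[_ _] /= [[m Pm <-] [n Pn <-]].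
  rewrite ballEmdist/= embed_dist -[embed (mkelt (x_ m))](subrK f) -addrA.
  rewrite (le_lt_trans (ler_rnormD _ _))// [ltRHS]splitr ltrD//.
  by rewrite rnorm_sub.
exists l; apply/eqP; rewrite -subr_eq0; apply/eqP/rnorm_eq0/eqP.
rewrite eq_le rnorm_ge0 andbT; apply/ler_addgt0Pr => e e0; rewrite add0r.
have e20 : 0 < e / 2 by rewrite divr_gt0.
near \oo => n.
rewrite -[embed (mkelt l)](subrK (embed (mkelt (x_ n)))) -addrA.
rewrite (le_trans (ler_rnormD _ _))// [leRHS]splitr lerD//.
  rewrite -embed_dist ltW//; near: n.
  exact: metricType_numDomainType.cvgr_dist_lt.
by rewrite rnorm_sub ltW//; near: n; exact: xP.
Unshelve. all: by end_near. Qed.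

Lemma embed_pi_unit a (f : rkhs K) : rnorm f = 1 ->
  exists x : M a, embed (mkelt x) = p a f.
Proof.
move=> f1; apply: embed_closed => e e0.
have a1 : 0 < rnorm a + 1 by rewrite ltr_wpDl ?rnorm_ge0.
(* Three errors of [e / 3]: replacing [f] by the plain sum [S], the bound in (BallImg), where the
   norm of [S] is close to 1, and the slack in the infimum. *)
have d0 : 0 < e / 3 / (rnorm a + 1) by rewrite !divr_gt0.
have da : e / 3 / (rnorm a + 1) * rnorm a <= e / 3.
  by rewrite mulrAC ler_pdivrMr// ler_wpM2l ?lerDl// ltW// divr_gt0.
have [s fs] := embed_sum_dense f d0.
set S := \sum_(x <- s) embed x in fs.
have sa : `|norm_sum s - 1| * rnorm a <= e / 3.
  apply: le_trans da; rewrite ler_wpM2r ?rnorm_ge0//.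
  apply: le_trans (ltW fs); rewrite embed_norm_sum -/S -f1 ler_norml.
  rewrite lerBlDl lerNl opprB lerBlDl; apply/andP; split.
    by rewrite -[in leLHS](subrK S f) addrC ler_rnormD.
  by rewrite rnorm_sub -[in leLHS](subrK f S) addrC ler_rnormD.
have e3 : 0 < e / 3 by rewrite divr_gt0.
have : inf (range (fun z : M a =>
    norm_sum (rcons [seq elt_pi a x | x <- s] (mkelt (mopp z))))) < e / 3 + e / 3.
  by rewrite (le_lt_trans (pm_ball MP a s))// ltr_pwDr.
move=> /(inf_norm_sum_lt (carrier_inhabited M a))[z]; rewrite embed_norm_sum.
rewrite big_rcons big_map; under eq_bigr do rewrite embed_pi.
rewrite -rep_sum -/S -[mkelt (mopp z)]/(elt_opp (mkelt z)) embed_opp => zS; exists z.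
rewrite -[p a f](subrK (p a S)) -addrA (le_lt_trans (ler_rnormD _ _))//.
have -> : e = e / 3 + (e / 3 + e / 3) by field.
rewrite ler_ltD// -repN -repD (le_trans (rep_contractive _ _ _))//.
by apply: le_trans da; rewrite mulrC ler_wpM2r ?rnorm_ge0// ltW.
Qed.

(** The bound of (BallImg) is small only near the unit sphere: [f] is normalised first, and the
    element found is shrunk by the factor [rnorm f] inside its sort. *)
Lemma embed_pi_ball a (f : rkhs K) : rnorm f <= 1 ->
  exists x : M a, embed (mkelt x) = p a f.
Proof.
move=> f1; have [->|f0] := eqVneq f 0.
  by exists (mzero M a); rewrite rep0 embed_zero.
have n0 : rnorm f != 0 by apply: contra_neq f0; exact: rnorm_eq0.
have [|x xE] := @embed_pi_unit a ((rnorm f)^-1%:C *: f).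
  by rewrite rnormZ [complex.Re _]cabs_real ger0_norm ?invr_ge0 ?rnorm_ge0// mulVf.
have [y yE] := is_multiple01 MP x (rnorm_ge0 f) f1.
exists y; rewrite (embed_multiple yE) xE repZ scalerA -rmorphM/= mulfV//.
by rewrite rmorph1 scale1r.
Qed.

Lemma embed_approx a (x : M a) e : 0 < e ->
  exists b, rnorm b <= 1 /\
    exists y : M b, rnorm (embed (mkelt x) - p a (embed (mkelt y))) < e.
Proof.
move=> e0; have e20 : 0 < e / 2 by rewrite divr_gt0.
have /closure_rnorm/(_ _ e20)[_ [b b1 ->] ab] := @A_ball a.
rewrite rnorm_le1 in b1; exists b; split=> //.
have : inf (range (fun z : M (bmul a b) => norm_sum [:: mkelt z; mkelt (mopp x)])) < e / 2.
  apply: le_lt_trans ab; apply: le_trans (pm_haus MP a (bmul a b)).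
  (* The infima are bounded by the radius of the sort, as the choice of 0 for the inner variable
     shows. *)
  refine (@inf_le_sup _ _ M _ _
    (fun (x : M a) (z : M (bmul a b)) => [:: mkelt z; mkelt (mopp x)]) (rnorm a) x _) => {}x.
  exists (mzero M _); rewrite embed_norm_sum !big_cons big_nil addr0.
  rewrite embed_zero add0r -[mkelt (mopp x)]/(elt_opp (mkelt x)) embed_opp rnormN.
  by rewrite -[embed _]subr0 -(embed_zero a) -embed_dist (pm_radius MP).
move=> /(inf_norm_sum_lt (carrier_inhabited M _))[z zx].
have : inf (range (fun w : M b => norm_sum [:: mkelt (mpi a w); mkelt (mopp z)])) < e / 2.
  apply: le_lt_trans e20; rewrite -(pm_dense MP a b).
  refine (@inf_le_sup _ _ M _ _
    (fun (z : M (bmul a b)) (w : M b) => [:: mkelt (mpi a w); mkelt (mopp z)])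
    (rnorm (bmul a b)) z _) => {zx}z.
  exists (mzero M _); rewrite embed_norm_sum !big_cons big_nil addr0.
  rewrite -[mkelt (mpi _ _)]/(elt_pi a (mkelt (mzero M b))) embed_pi embed_zero rep0.
  rewrite add0r -[mkelt (mopp z)]/(elt_opp (mkelt z)) embed_opp rnormN.
  by rewrite -[embed _]subr0 -(embed_zero (bmul a b)) -embed_dist (pm_radius MP).
move=> /(inf_norm_sum_lt (carrier_inhabited M _))[w wz]; exists w.
move: zx wz; rewrite !embed_norm_sum !big_cons !big_nil !addr0.
rewrite -[mkelt (mopp x)]/(elt_opp (mkelt x)) -[mkelt (mopp z)]/(elt_opp (mkelt z)).
rewrite -[mkelt (mpi _ _)]/(elt_pi a (mkelt w)) embed_pi !embed_opp => zx wz.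
rewrite -[embed (mkelt x)](subrK (embed (mkelt z))) -addrA.
apply: (le_lt_trans (ler_rnormD _ _)); rewrite [ltRHS]splitr; apply: ltrD.
  by rewrite (rnorm_sub (embed (mkelt x))); exact: zx.
by rewrite (rnorm_sub (embed (mkelt z))); exact: wz.
Qed.

Lemma embed_realization : realization p (fun a (x : M a) => embed (mkelt x)).
Proof.
split.
- move=> a f; split=> [/rep_sortP af|[x <-]].
    apply: embed_closed => e /af[g /(embed_pi_ball a)[x xE] fg].
    by exists x; rewrite xE.
  apply/rep_sortP => e /(embed_approx x)[b [b1 [y xy]]].
  exists (embed (mkelt y)) => //.
  rewrite -[embed _]subr0 -(embed_zero b) -embed_dist.
  exact: le_trans (pm_radius MP y) b1.
- exact: embed_dist.
- exact: embed_zero.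
- by move=> a x; exact: (embed_opp (mkelt x)).
- exact: embed_mid.
- by move=> a x; exact: (embed_i (mkelt x)).
- by move=> a b x; exact: (embed_pi a (mkelt x)).
- by move=> a b x y; exact: (rinner_embed (mkelt x) (mkelt y)).
Qed.

(** Each [embed x] is a limit of vectors [p a y] by [embed_approx], and sums of such vectors are
    dense. *)
Lemma model_rep_nondegenerate : nondegenerate_rep p.
Proof.
apply/seteqP; split=> // f _ F [[F0 Flin Fcl] Fp]; apply: (Fcl).
apply/closure_rnorm => e /(embed_sum_dense f)[s fs]; exists (\sum_(x <- s) embed x) => //.
elim/big_rec: _ => // -[a x] g _ Fg; rewrite -[embed _]scale1r; apply: Flin => //.
apply: (Fcl); apply/closure_rnorm => d /(embed_approx x)[b [_ [y xy]]].
by exists (p a (embed (mkelt y))) => //; apply: Fp; exists a, (embed (mkelt y)).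
Qed.

End ModelRealization.

(** * Axiomatization *)

Section Formulas.
Variables (R : realType) (L : language R).
Implicit Types (G : seq (lsort L)) (M : lstructure L).

(** [F] is given on all structures at once, since a single formula must compute it in each of
    them. *)
Definition definable G (F : forall M, env M G -> R) :=
  exists phi : formula G, forall M (e : env M G), formula_eval phi e = F M e.

Lemma definable_comp G (F : forall M, env M G -> R) (u : R -> R) :
  continuous u -> definable F -> definable (fun M e => u (F M e)).
Proof.
move=> uc [phi phiE].
have uc' : continuous (fun v : 'rV[R]_1 => u (v 0 0)).
  by move=> v; apply: (@continuous_comp _ _ _ (fun v : 'rV[R]_1 => v 0 0));
    [exact: coord_continuous|exact: uc].
by exists (FConn uc' (fun=> phi)) => M e; rewrite /= mxE phiE.
Qed.

Lemma definable_add G (F F' : forall M, env M G -> R) :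
  definable F -> definable F' -> definable (fun M e => F M e + F' M e).
Proof.
move=> [phi phiE] [psi psiE].
have uc : continuous (fun v : 'rV[R]_2 => v 0 0 + v 0 1).
  move=> v; apply: cvgD; first exact: nbhs_filter.
    exact: coord_continuous.
  exact: coord_continuous.
by exists (FConn uc (fun i => if i == 0 then phi else psi)) => M e; rewrite /= !mxE phiE psiE.
Qed.

Lemma definable_mulc G (F : forall M, env M G -> R) (c : R) :
  definable F -> definable (fun M e => c * F M e).
Proof. by apply: (@definable_comp _ _ ( *%R c)) => x; exact: mulrl_continuous. Qed.

Lemma definable_cst G (c : R) : definable (fun M (e : env M G) => c).
Proof.
have uc : continuous (fun v : 'rV[R]_0 => c) by exact: cst_continuous.
have no (i : 'I_0) : formula G by case: i.
by exists (FConn uc no).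
Qed.

Lemma definable_inf G (s : lsort L) (F : forall M, env M (s :: G) -> R) :
  definable F -> definable (fun M (e : env M G) => inf (range (fun x : M s => F M (x, e)))).
Proof.
move=> [phi phiE]; exists (FInf phi) => M e /=.
by congr inf; apply: eq_imagel => x _; rewrite phiE.
Qed.

Lemma definable_sup G (s : lsort L) (F : forall M, env M (s :: G) -> R) :
  definable F -> definable (fun M (e : env M G) => sup (range (fun x : M s => F M (x, e)))).
Proof.
move=> [phi phiE]; exists (FSup phi) => M e /=.
by congr sup; apply: eq_imagel => x _; rewrite phiE.
Qed.

Lemma definable_dist G (s : lsort L) (t t' : term G s) :
  definable (fun M e => mdist (term_eval e t) (term_eval e t')).
Proof. by exists (FDist t t'). Qed.

Lemma definable_pred G (q : lpred L) (ts : terms G (lpred_dom q)) :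
  definable (fun M e => terms_eval e ts (pred_interp M q)).
Proof. by exists (FPred ts). Qed.

Definition clamp (r : R) : R := Num.min 1 (Num.max 0 r).

Lemma clamp_continuous : continuous clamp.
Proof.
by move=> r; apply: continuous_min; [exact: cvg_cst|apply: continuous_max; [exact: cvg_cst|]].
Qed.

Lemma clamp_ge0 r : 0 <= clamp r.
Proof. by rewrite le_min ler01 le_max lexx. Qed.

Lemma clamp_le1 r : clamp r <= 1.
Proof. by rewrite ge_min lexx. Qed.

Lemma clamp_eq0 r : clamp r = 0 <-> r <= 0.
Proof.
split=> [r0|r0]; last by rewrite /clamp max_l// min_r.
rewrite leNgt; apply/negP => rp.
have : 0 < clamp r by rewrite lt_min ltr01 lt_max rp orbT.
by rewrite r0 ltxx.
Qed.

(* Universal closure.  Clamping the values to [0, 1] bounds the nested suprema,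
   which would otherwise be junk. *)
Fixpoint formula_closure G : formula G -> sentence L :=
  match G return formula G -> sentence L with
  | [::] => id
  | s :: G' => fun phi => formula_closure (FSup phi)
  end.

Lemma formula_closureP M G (phi : formula G) :
  (forall e : env M G, 0 <= formula_eval phi e <= 1) ->
  @formula_eval R L M [::] (formula_closure phi) tt = 0 <->
  forall e : env M G, formula_eval phi e = 0.
Proof.
elim: G phi => [|s G IH] phi phi01 /=.
  by split=> [H []|/(_ tt)].
have ub (e : env M G) (x : M s) :
    formula_eval (M := M) phi (x, e) <= formula_eval (FSup phi) e.
  by apply: ub_le_sup; [exists 1 => _ [y _ <-]; have /andP[] := phi01 (y, e)|exists x].
have sup01 (e : env M G) : 0 <= formula_eval (FSup phi) e <= 1.
  have [x] := carrier_inhabited M s; apply/andP; split.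
    by apply: le_trans (ub e x); case/andP: (phi01 (x, e)).
  apply: ge_sup; first by exists (formula_eval phi (x, e)), x.
  by move=> _ [y _ <-]; case/andP: (phi01 (y, e)).
rewrite IH//; split=> H => [[x e]|e].
  apply/eqP; rewrite eq_le; case/andP: (phi01 (x, e)) => -> _.
  by rewrite andbT -(H e) ub.
apply/eqP; rewrite eq_le; case/andP: (sup01 e) => -> _; rewrite andbT.
have [x] := carrier_inhabited M s.
apply: ge_sup; first by exists (formula_eval phi (x, e)), x.
by move=> _ [y _ <-]; rewrite le_eqVlt; apply/orP; left; apply/eqP; exact: (H (y, e)).
Qed.

(** With all sentences true in [C], one half of axiomatizability is immediate; the other half only
    needs certain conditions to be expressible. *)
Definition theory_of (C : lstructure L -> Prop) : theory L :=
  [set phi | forall M, C M -> @formula_eval R L M [::] phi tt = 0].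

Lemma theory_of_le (C : lstructure L -> Prop) G (F F' : forall M, env M G -> R) :
  definable F -> definable F' ->
  (forall M, C M -> forall e, F M e <= F' M e) ->
  forall M, satisfies M (theory_of C) -> forall e, F M e <= F' M e.
Proof.
move=> FD F'D FF' M MT e.
have [phi phiE] : definable (fun M e => clamp (F M e + -1 * F' M e)).
  apply: definable_comp; first exact: clamp_continuous.
  by apply: definable_add => //; exact: definable_mulc.
have phi01 N (e' : env N G) : 0 <= formula_eval phi e' <= 1.
  by rewrite phiE clamp_ge0 clamp_le1.
have /(formula_closureP (phi01 M))/(_ e) :
    @formula_eval R L M [::] (formula_closure phi) tt = 0.
  apply: MT => N NC; apply/(formula_closureP (phi01 N)) => e'.
  by rewrite phiE; apply/clamp_eq0; rewrite mulN1r subr_le0; exact: FF'.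
by rewrite phiE => /clamp_eq0; rewrite mulN1r subr_le0.
Qed.

Lemma theory_of_eq (C : lstructure L -> Prop) G (F F' : forall M, env M G -> R) :
  definable F -> definable F' ->
  (forall M, C M -> forall e, F M e = F' M e) ->
  forall M, satisfies M (theory_of C) -> forall e, F M e = F' M e.
Proof.
move=> FD F'D FF' M MT e; apply/eqP; rewrite eq_le.
by apply/andP; split; apply: (theory_of_le _ _ _ MT) => // N NC e'; rewrite FF'.
Qed.

Fixpoint ctx_vars G : seq {s & var G s} :=
  match G return seq {s & var G s} with
  | [::] => [::]
  | s :: G' => existT _ s (VarO G' s) ::
      [seq existT _ (projT1 v) (VarS s (projT2 v)) | v <- ctx_vars G']
  end.

End Formulas.

(** * Terms and formulas of the language of [A] *)

Section LanguageLAFormulas.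
Variables (R : realType) (A : banachStarAlgType R).
Local Notation L := (LA A).
Implicit Types (G : seq A) (M : lstructure L) (a b : A).

Definition telt G := {a : A & @term R L G a}.

Definition telt_eval M G (e : env M G) (u : telt G) : elt M :=
  mkelt (term_eval e (projT2 u)).

Definition te_var G (v : {a : A & @var R L G a}) : telt G :=
  existT _ (projT1 v) (@TVar R L G _ (projT2 v)).
Definition te_zero G a : telt G := existT _ a (@TApp R L G (LA_zero a) (@TNil R L G)).
Definition te_opp G (u : telt G) : telt G :=
  existT _ (projT1 u) (@TApp R L G (LA_opp (projT1 u)) (TCons (projT2 u) (@TNil R L G))).
Definition te_i G (u : telt G) : telt G :=
  existT _ (projT1 u) (@TApp R L G (LA_i (projT1 u)) (TCons (projT2 u) (@TNil R L G))).
Definition te_pi G a (u : telt G) : telt G :=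
  existT _ (bmul a (projT1 u))
    (@TApp R L G (LA_pi a (projT1 u)) (TCons (projT2 u) (@TNil R L G))).
Definition te_mid G a (t t' : @term R L G a) : telt G :=
  existT _ a (@TApp R L G (LA_mid a) (TCons t (TCons t' (@TNil R L G)))).

Lemma definable_br G (u v : telt G) :
  definable (fun M (e : env M G) => elt_br (telt_eval e u) (telt_eval e v)).
Proof.
exact: (@definable_pred R L G (projT1 u, projT1 v)
  (TCons (projT2 u) (TCons (projT2 v) (@TNil R L G)))).
Qed.

Lemma definable_big G (J : Type) (r : seq J) (F : J -> forall M, env M G -> R) :
  (forall j, definable (F j)) -> definable (fun M (e : env M G) => \sum_(j <- r) F j M e).
Proof.
move=> FD; elim: r => [|j r [phi phiE]].
  have [phi phiE] := @definable_cst R L G 0.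
  by exists phi => M e; rewrite phiE big_nil.
have [psi psiE] : definable (fun M (e : env M G) => F j M e + \sum_(i <- r) F i M e).
  by apply: definable_add; [exact: FD|exists phi].
by exists psi => M e; rewrite psiE big_cons.
Qed.

Lemma definable_norm_comb G (s : seq (R * telt G)) :
  definable (fun M (e : env M G) => norm_comb [seq (u.1, telt_eval e u.2) | u <- s]).
Proof.
have [phi phiE] : definable (fun M (e : env M G) => Num.sqrt (\sum_(u <- s) \sum_(v <- s)
    u.1 * v.1 * elt_br (telt_eval e u.2) (telt_eval e v.2))).
  apply: definable_comp; first exact: sqrt_continuous.
  apply: definable_big => u; apply: definable_big => v.
  apply: definable_mulc; exact: definable_br.
exists phi => M e; rewrite phiE /norm_comb big_map; congr Num.sqrt.
by apply: eq_bigr => u _; rewrite big_map.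
Qed.

Lemma definable_br_sum G (s : seq (telt G)) :
  definable (fun M (e : env M G) => br_sum (map (telt_eval e) s)).
Proof.
have [phi phiE] : definable (fun M (e : env M G) =>
    \sum_(u <- s) \sum_(v <- s) elt_br (telt_eval e u) (telt_eval e v)).
  by apply: definable_big => u; apply: definable_big => v; exact: definable_br.
exists phi => M e; rewrite phiE /br_sum big_map.
by apply: eq_bigr => u _; rewrite big_map.
Qed.

Lemma definable_norm_sum G (s : seq (telt G)) :
  definable (fun M (e : env M G) => norm_sum (map (telt_eval e) s)).
Proof. by apply: definable_comp; [exact: sqrt_continuous|exact: definable_br_sum]. Qed.

Definition ctx_elts G : seq (telt G) := map (@te_var G) (@ctx_vars R L G).

Definition elt_sort M (x : elt M) : lsort L := projT1 x.

Fixpoint elts_env M (s : seq (elt M)) : env M (map (@elt_sort M) s) :=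
  match s return env M (map (@elt_sort M) s) with
  | [::] => tt
  | x :: s' => (projT2 x, elts_env s')
  end.

(** A scheme over arbitrary finite sequences becomes one condition for each list of sorts: the
    sequence is the environment, and the variables of the context read it back. *)
Lemma elts_envK M (s : seq (elt M)) : map (telt_eval (elts_env s)) (ctx_elts _) = s.
Proof.
elim: s => [//|[a x] s IH] /=; congr (_ :: _).
by rewrite -[RHS]IH /ctx_elts -!map_comp.
Qed.

Lemma mkelt_inj M a : injective (@mkelt R A M a).
Proof.
move=> x y xy; have := projT2_eq xy.
by rewrite (Prop_irrelevance (projT1_eq xy) erefl).
Qed.

(* Equality of two elements whose sorts are equal, but perhaps not convertible,
   is expressed by transporting a term. *)
Definition term_cast G a b (ab : a = b) (t : @term R L G a) : @term R L G b :=
  ecast c (@term R L G c) ab t.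

Lemma term_castE M G (e : env M G) a b (ab : a = b) t :
  mkelt (term_eval e (term_cast ab t)) = mkelt (term_eval e t).
Proof. by case: b / ab. Qed.

Lemma theory_of_elt_eq (C : lstructure L -> Prop) G (u v : telt G) :
  projT1 u = projT1 v ->
  (forall M, C M -> forall e : env M G, telt_eval e u = telt_eval e v) ->
  forall M, satisfies M (theory_of C) -> forall e : env M G, telt_eval e u = telt_eval e v.
Proof.
case: u v => [a u] [b v] /= ab uv M MT e.
rewrite /telt_eval /= -(term_castE e ab); congr mkelt; apply: mdist_positivity.
have D := @definable_dist R L G b (term_cast ab u) v.
apply: (theory_of_eq D (@definable_cst R L G 0) _ MT) => N NC e'.
suff -> : term_eval e' (term_cast ab u) = term_eval e' v by rewrite mdistxx.
by apply: mkelt_inj; rewrite term_castE; exact: uv.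
Qed.

End LanguageLAFormulas.

(** * Expressing the premodel conditions by sentences *)

Section TheoryPremodel.
Variables (R : realType) (A : banachStarAlgType R).
Local Notation L := (LA A).
Implicit Types (G : seq A) (a b : A).

Let v0 G a : @term R L (a :: G) a := TVar (@VarO R L G a).
Let v1 G a b : @term R L (a :: b :: G) b := TVar (@VarS R L (b :: G) b a (@VarO R L G b)).
Let v2 G a b c : @term R L (a :: b :: c :: G) c :=
  TVar (@VarS R L (b :: c :: G) c a (@VarS R L (c :: G) c b (@VarO R L G c))).
Let x0 G a : telt (a :: G) := existT _ a (v0 G a).
Let x1 G a b : telt (a :: b :: G) := existT _ b (v1 G a b).
Let x2 G a b c : telt (a :: b :: c :: G) := existT _ c (v2 G a b c).
(** The variables of [G], weakened past the one that the infimum of (BallImg) binds. *)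
Let ctx_lift G a : seq (telt (a :: G)) :=
  [seq te_var (existT _ (projT1 v) (@VarS R L G (projT1 v) a (projT2 v))) |
   v <- @ctx_vars R L G].

Let eval_ball (M : lstructure L) G a (e : env M G) (z : M a) :
  map (@telt_eval R A M (a :: G) (z, e))
    (rcons (map (te_pi a) (ctx_lift G a)) (te_opp (x0 G a))) =
  rcons [seq elt_pi a x | x <- map (telt_eval e) (ctx_elts G)] (mkelt (mopp z)).
Proof.
by rewrite map_rcons; congr rcons; rewrite /ctx_lift /ctx_elts -!map_comp.
Qed.

(** Each clause holds in every model by [model_premodel] and is expressible, hence passes to [M]. *)
Lemma theory_premodel (M : lstructure L) :
  satisfies M (theory_of (@model_TA R A)) -> premodel M.
Proof.
move=> MT; split.
- move=> a x y.
  exact: (@theory_of_eq R L _ [:: a; a] _ _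
    (definable_dist (v0 [:: a] a) (v1 [::] a a))
    (definable_mulc 2 (definable_dist
      (projT2 (te_mid (v0 [:: a] a) (projT2 (te_opp (x1 [::] a a)))))
      (projT2 (te_zero [:: a; a] a))))
    (fun N NC e => pm_dist (model_premodel NC) e.1 e.2.1) M MT (x, (y, tt))).
- move=> a x; apply: mkelt_inj.
  exact: (@theory_of_elt_eq R A _ [:: a]
    (te_mid (v0 [::] a) (projT2 (te_opp (x0 [::] a)))) (te_zero [:: a] a) erefl
    (fun N NC e => congr1 (@mkelt R A N a) (pm_mid_opp (model_premodel NC) e.1)) M MT (x, tt)).
- move=> a x.
  exact: (@theory_of_le R L _ [:: a] _ _
    (definable_dist (v0 [::] a) (projT2 (te_zero [:: a] a)))
    (@definable_cst R L [:: a] (rnorm a))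
    (fun N NC e => pm_radius (model_premodel NC) e.1) M MT (x, tt)).
- move=> [a x] [b y].
  exact: (@theory_of_eq R L _ [:: a; b] _ _
    (definable_br (x0 [:: b] a) (x1 [::] a b)) (definable_br (x1 [::] a b) (x0 [:: b] a))
    (fun N NC e => pm_sym (model_premodel NC) (mkelt e.1) (mkelt e.2.1)) M MT (x, (y, tt))).
- move=> a [b x] y y'.
  rewrite mulrC.
  exact: (@theory_of_eq R L _ [:: b; a; a] _ _
    (definable_br (x0 [:: a; a] b) (te_mid (v1 [:: a] b a) (v2 [::] b a a)))
    (definable_mulc 2^-1 (definable_add
      (definable_br (x0 [:: a; a] b) (x1 [:: a] b a))
      (definable_br (x0 [:: a; a] b) (x2 [::] b a a))))
    (fun N NC e => etrans (pm_mid (model_premodel NC) (mkelt e.1) e.2.1 e.2.2.1) (mulrC _ _))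
    M MT (x, (y, (y', tt)))).
- move=> a [b x].
  exact: (@theory_of_eq R L _ [:: b] _ _
    (definable_br (x0 [::] b) (te_zero [:: b] a)) (@definable_cst R L [:: b] 0)
    (fun N NC e => pm_zero (model_premodel NC) a (mkelt e.1)) M MT (x, tt)).
- move=> a x.
  have sqr_cont : continuous (fun r : R => r ^+ 2) by exact: exprn_continuous.
  exact: (@theory_of_eq R L _ [:: a] _ _
    (definable_br (x0 [::] a) (x0 [::] a))
    (definable_comp sqr_cont (definable_dist (v0 [::] a) (projT2 (te_zero [:: a] a))))
    (fun N NC e => pm_norm (model_premodel NC) e.1) M MT (x, tt)).
- move=> s; rewrite -(elts_envK s); set G := map _ s.
  exact: (@theory_of_le R L _ G _ _ (@definable_cst R L G 0) (definable_br_sum (ctx_elts G))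
    (fun N NC e => pm_pos (model_premodel NC) _) M MT (elts_env s)).
- move=> a s; rewrite -(elts_envK s); set G := map _ s.
  have piE (N : lstructure L) (e : env N G) :
      [seq elt_pi a x | x <- map (telt_eval e) (ctx_elts G)] =
      map (telt_eval e) (map (te_pi a) (ctx_elts G)) by rewrite -!map_comp.
  rewrite piE.
  apply: (@theory_of_le R L _ G _ _ (definable_norm_sum (map (te_pi a) (ctx_elts G)))
    (definable_mulc (rnorm a) (definable_norm_sum (ctx_elts G)))
    _ M MT (elts_env s)) => N NC e.
  by rewrite -piE; exact: (pm_pi (model_premodel NC)).
- move=> a b [c x].
  exact: (@theory_of_eq R L _ [:: c] _ _
    (definable_norm_sum [:: te_pi (a + b) (x0 [::] c); te_opp (te_pi a (x0 [::] c));
      te_opp (te_pi b (x0 [::] c))]) (@definable_cst R L [:: c] 0)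
    (fun N NC e => pm_pi_add (model_premodel NC) a b (mkelt e.1)) M MT (x, tt)).
- move=> k a [c x].
  exact: (@theory_of_eq R L _ [:: c] _ _
    (definable_norm_comb [:: (1, te_pi (k *: a) (x0 [::] c));
      (- complex.Re k, te_pi a (x0 [::] c)); (- complex.Im k, te_i (te_pi a (x0 [::] c)))])
    (@definable_cst R L [:: c] 0)
    (fun N NC e => pm_pi_scale (model_premodel NC) k a (mkelt e.1)) M MT (x, tt)).
- move=> a b [c x].
  exact: (@theory_of_elt_eq R A _ [:: c]
    (te_pi (bmul a b) (x0 [::] c)) (te_pi a (te_pi b (x0 [::] c))) (esym (bmulA a b c))
    (fun N NC e => pm_pi_mul (model_premodel NC) a b (mkelt e.1)) M MT (x, tt)).
- move=> a [b x] [c y].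
  exact: (@theory_of_eq R L _ [:: b; c] _ _
    (definable_br (te_pi a (x0 [:: c] b)) (x1 [::] b c))
    (definable_br (x0 [:: c] b) (te_pi (bstar a) (x1 [::] b c)))
    (fun N NC e => pm_pi_star (model_premodel NC) a (mkelt e.1) (mkelt e.2.1))
    M MT (x, (y, tt))).
- move=> [a x] [b y].
  exact: (@theory_of_eq R L _ [:: a; b] _ _
    (definable_br (te_i (x0 [:: b] a)) (te_i (x1 [::] a b)))
    (definable_br (x0 [:: b] a) (x1 [::] a b))
    (fun N NC e => pm_i_br (model_premodel NC) (mkelt e.1) (mkelt e.2.1)) M MT (x, (y, tt))).
- move=> [a x].
  exact: (@theory_of_elt_eq R A _ [:: a] (te_i (te_i (x0 [::] a))) (te_opp (x0 [::] a)) erefl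
    (fun N NC e => pm_i_sqr (model_premodel NC) (mkelt e.1)) M MT (x, tt)).
- move=> a [b x].
  exact: (@theory_of_elt_eq R A _ [:: b]
    (te_i (te_pi a (x0 [::] b))) (te_pi a (te_i (x0 [::] b))) erefl
    (fun N NC e => pm_i_pi (model_premodel NC) a (mkelt e.1)) M MT (x, tt)).
- move=> a s; rewrite -(elts_envK s); set G := map _ s.
  have cont : continuous (fun r : R => `|r| * rnorm a).
    by move=> r; apply: cvgMr_tmp; exact: cvg_norm.
  have ballE (N : lstructure L) (e : env N G) :
      (fun z : N a => norm_sum (rcons [seq elt_pi a x | x <- map (telt_eval e) (ctx_elts G)]
        (mkelt (mopp z)))) =
      (fun z : N a => norm_sum (map (@telt_eval R A N (a :: G) (z, e))
        (rcons (map (te_pi a) (ctx_lift G a)) (te_opp (x0 G a))))).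
    by apply/funext => z; rewrite eval_ball.
  rewrite ballE.
  apply: (@theory_of_le R L _ G _ _
    (definable_inf (definable_norm_sum
      (rcons (map (te_pi a) (ctx_lift G a)) (te_opp (x0 G a)))))
    (definable_comp cont (definable_add (definable_norm_sum (ctx_elts G))
      (@definable_cst R L G (-1)))) _ M MT (elts_env s)) => N NC e.
  by rewrite -ballE; exact: (pm_ball (model_premodel NC)).
- move=> a b.
  exact: (@theory_of_eq R L _ [::] _ _
    (definable_sup (definable_inf (definable_norm_sum
      [:: te_pi a (x0 [:: bmul a b] b); te_opp (x1 [::] b (bmul a b))])))
    (@definable_cst R L [::] 0)
    (fun N NC e => pm_dense (model_premodel NC) a b) M MT tt).
- move=> a b.
  exact: (@theory_of_le R L _ [::] _ _
    (definable_sup (definable_inf (definable_norm_sum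
      [:: x0 [:: a] b; te_opp (x1 [::] b a)])))
    (@definable_cst R L [::] (rnorm (a - b)))
    (fun N NC e => pm_haus (model_premodel NC) a b) M MT tt).
Qed.

End TheoryPremodel.

(** A right approximate identity gives the closure condition directly; the involution turns a left
    one into a right one with the same norms. *)
Lemma norm1_approx_id_ball (R : realType) (A : banachStarAlgType R) :
  left_norm1_approx_id A \/ right_norm1_approx_id A \/
    (forall a : A, in_closure_mul_ball a) ->
  forall a : A, in_closure_mul_ball a.
Proof.
have right_ball : right_norm1_approx_id A -> forall a : A, in_closure_mul_ball a.
  move=> [I [F [e [FF e1 ea]]]] a B /(ea a) FB.
  have [i Bi] := filter_ex (FB : F [set i | B (bmul a (e i))]).
  by exists (bmul a (e i)); split=> //; exists (e i); rewrite ?e1.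
case=> [[I [F [e [FF e1 ea]]]]|[]] //; apply: right_ball.
exists I, F, (fun i => bstar (e i)); split=> // [i|a]; first by rewrite bnorm_star.
apply/cvgrPdist_lt => r r0.
have /cvgrPdist_lt/(_ r r0) := ea (bstar a).
apply: filterS => i; rewrite -(bnorm_star (_ - _)) -scaleN1r bstarD bstarZ.
by rewrite bstarM bstarK (_ : (-1)^* = -1) ?scaleN1r// rmorphN1.
Qed.

Theorem theorem1p6 (R : realType) (A : banachStarAlgType R)
    (hA : left_norm1_approx_id A \/ right_norm1_approx_id A \/
          forall a : A, in_closure_mul_ball a) :
  (forall (E : hilbertType R) (p : star_rep A E), nondegenerate_rep p ->
     model_TA (rep_structure p)) /\
  (forall M : lstructure (LA A), model_TA M ->
     (exists (E : hilbertType R) (p : star_rep A E),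
        nondegenerate_rep p /\ isomorphic M (rep_structure p)) /\
     (forall (E E' : hilbertType R) (p : star_rep A E) (p' : star_rep A E'),
        nondegenerate_rep p -> nondegenerate_rep p' ->
        isomorphic M (rep_structure p) -> isomorphic M (rep_structure p') ->
        unitarily_equivalent p p')) /\
  (exists T : theory (LA A),
     axiomatizes T (@model_TA R A) /\
     axiomatizes T (fun M => exists (E : hilbertType R) (p : star_rep A E),
       nondegenerate_rep p /\ isomorphic M (rep_structure p))).
Proof.
have hball := norm1_approx_id_ball hA.
have iso_model M (E : hilbertType R) (p : star_rep A E) :
    isomorphic M (rep_structure p) -> model_TA M.
  by move=> /isomorphic_realization[g]; exact: realization_model.
have premodel_rep (M : lstructure (LA A)) : premodel M ->
    exists (E : hilbertType R) (p : star_rep A E),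
      nondegenerate_rep p /\ isomorphic M (rep_structure p).
  move=> MP; exists (rkhs (model_kernel MP)), (model_rep MP); split.
    exact: model_rep_nondegenerate.
  by apply/isomorphic_realization; eexists; exact: embed_realization.
split; [|split].
(* The identity maps form an isomorphism of M(E, p) with itself. *)
- move=> E p _; apply: (iso_model _ E p); exists (fun _ => id); split=> //.
  + by move=> s; exists id.
  + by case=> [a|a|a|a|a b] => // x _ -> // y _ ->.
  + by move=> [a b] x _ -> y _ ->.
- move=> M MM; split; first exact/premodel_rep/model_premodel.
  move=> E E' p p' pN pN' /isomorphic_realization[g gR] /isomorphic_realization[g' gR'].
  exact: realization_unitary pN pN' gR gR'.
- exists (theory_of (@model_TA R A)); split=> M; split.
  (* The sentences only yield a premodel; the full axioms, (Conv) included, come back through the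
     representation. *)
  + by move=> /theory_premodel/premodel_rep[E [p [_]]]; exact: iso_model.
  + by move=> MM phi; exact.
  + by move=> /theory_premodel/premodel_rep.
  + by move=> [E [p [_ /iso_model MM]]] phi; exact.
Qed.
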